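(* Let $Z$ be a striped surface with a fixed striped atlas $q: Z_0=\bigsqcup_{\alpha\in A} S_\alpha \to Z$, let $G$ be the graph of the striped atlas $q$, and let $\varphi: G\to Z$ be the canonical continuous injection (constructed for any choice of points $z_\beta$ in the seams $\omega_\beta$, $\beta\in B$). Then for each $x\in G$ the map $\varphi$ induces an isomorphism of fundamental groups $$\varphi_*:\pi_1(G,x)\to\pi_1\bigl(Z,\varphi(x)\bigr).$$ In particular, $\varphi$ is a homotopy equivalence.
   Context: **Model strips.** A subset $S\subset\mathbb{R}\times[-1,1]$ is a *model strip* if (1) $\mathbb{R}\times(-1,1)\subset S$, and (2) $S\cap(\mathbb{R}\times\{\pm1\})$ is a union of at most countably many mutually disjoint open intervals (equivalently, $S$ is open in $\mathbb{R}\times[-1,1]$). Put $\partial_-S=S\cap(\mathbb{R}\times\{-1\})$, $\partial_+S=S\cap(\mathbb{R}\times\{1\})$, $\partial S=\partial_-S\cup\partial_+S$. The boundary intervals of $S$ are the connected components of $\partial S$. **Striped atlas.** Let $Z$ be a two-dimensional manifold (possibly non-orientable, disconnected, with boundary). A *striped atlas* on $Z$ is a map $q: Z_0\to Z$ such that: 1. $Z_0=\bigsqcup_{\alpha\in A}S_\alpha$ is an at most countable disjoint union of model strips; 2. $q$ is a quotient map; 3. there are two disjoint families $X=\{X_\beta\}_{\beta\in B}$ and $Y=\{Y_\beta\}_{\beta\in B}$ of boundary intervals in $\bigcup_{\alpha\in A}\partial S_\alpha$ such that (writing $X\cup Y$ also for the union of all intervals of the two families): (a) $q$ is injective on $Z_0\setminus(X\cup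 Y)$; (b) $q(X_\beta)=q(Y_\beta)$ for each $\beta\in B$, and the restrictions $q|_{X_\beta}:X_\beta\to q(X_\beta)$ and $q|_{Y_\beta}:Y_\beta\to q(Y_\beta)$ are embeddings; (c) $q(X_\beta)\cap q(X_{\beta'})=\varnothing$ for $\beta\neq\beta'\in B$; (d) $q(X_\beta)\cap q(Z_0\setminus(X\cup Y))=\varnothing$ for each $\beta\in B$. A *striped surface* is a surface admitting a striped atlas; one such atlas is fixed. The set $\omega_\beta=q(X_\beta)=q(Y_\beta)$ is called a *seam*. **Graph of the atlas.** $G$ is the one-dimensional CW-complex with $0$-skeleton $G^{(0)}=A$ and, for each $\beta\in B$, one $1$-cell $I_\beta=[-1,1]$ attached via $\chi_\beta:\{\pm1\}\to A$, $\chi_\beta(-1)=\alpha$, $\chi_\beta(1)=\alpha'$, where $X_\beta\subset\partial S_\alpha$ and $Y_\beta\subset\partial S_{\alpha'}$ (possibly $\alpha=\alpha'$). $G$ carries the CW (weak) topology. The characteristic map is also denoted $\chi_\beta: I_\beta\to G$. **Canonical injection $\varphi:G\to Z$.** For $\alpha\in A$ let $s_\alpha=(0,0)\in\mathbb{R}\times(-1,1)\subset S_\alpha$ and put $\varphi(\alpha)=q(s_\alpha)$. For each $\beta\in B$ fix a point $z_\beta\in\omega_\beta$; let $(x_\beta,\varepsilon)$ be the unique point of $q^{-1}(z_\beta)\cap X_\beta$ and $(y_\beta,\varepsilon')$ the unique point of $q^{-1}(z_\beta)\cap Y_\beta$, where $\varepsilon,\varepsilon'\in\{\pm1\}$. With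 $X_\beta\subset S_\alpha$ and $Y_\beta\subset S_{\alpha'}$, define $\varphi_\beta:I_\beta=[-1,1]\to Z$ by $$\varphi_\beta(t)=\begin{cases} q\bigl(2(1+t)x_\beta,(1+t)\varepsilon\bigr), & t\in[-1,-\tfrac12],\\ q\bigl(x_\beta,(1+t)\varepsilon\bigr), & t\in[-\tfrac12,0],\\ q\bigl(y_\beta,(1-t)\varepsilon'\bigr), & t\in[0,\tfrac12],\\ q\bigl(2(1-t)y_\beta,(1-t)\varepsilon'\bigr), & t\in[\tfrac12,1],\end{cases}$$ where the arguments of $q$ are points of $S_\alpha$ in the first two lines and of $S_{\alpha'}$ in the last two. The paths $\varphi_\beta$ agree with $\varphi$ on $G^{(0)}$ at their endpoints, and $\varphi:G\to Z$ is the resulting continuous injective map, with $\varphi\circ\chi_\beta=\varphi_\beta$. *)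

(* Defs.v *)
From HB Require Import structures.
From mathcomp Require Import all_boot all_order all_algebra.
From mathcomp Require Import generic_quotient monoid lra.
From mathcomp Require Import all_classical all_reals topology normedtype.

Set Implicit Arguments.
Unset Strict Implicit.
Unset Printing Implicit Defensive.

Import Order.TTheory GRing.Theory Num.Theory.
Import numFieldNormedType.Exports.

Local Open Scope classical_set_scope.
Local Open Scope ring_scope.

Section continuity.

Lemma within_continuous_comp_sub {T U V : topologicalType} (A : set T)
    (B : set U) (f : T -> U) (g : U -> V) :
  {within A, continuous f} -> (forall x, A x -> B (f x)) ->
  {within B, continuous g} -> {within A, continuous (g \o f)}.
Proof.
move=> /subspace_continuousP cf fAB /subspace_continuousP cg.
apply/subspace_continuousP => x Ax W nW /=.
have nV : within B (nbhs (f x)) (g @^-1` W) by exact: cg (fAB _ Ax) W nW.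
have := cf _ Ax _ nV.
change (nbhs x (fun y => A y -> B (f y) -> W (g (f y))) ->
        nbhs x (fun y => A y -> W (g (f y)))).
by apply: filterS => y h Ay; apply: h => //; exact: fAB.
Qed.

Lemma continuous_within {T U : topologicalType} (A : set T) (f : T -> U) :
  continuous f -> {within A, continuous f}.
Proof. exact: continuous_subspaceT. Qed.

Lemma within_continuous_eq {T U : topologicalType} (A : set T) (f g : T -> U) :
  (forall x, A x -> f x = g x) ->
  {within A, continuous f} -> {within A, continuous g}.
Proof.
by move=> fg; apply: subspace_eq_continuous => x; rewrite inE; exact: fg.
Qed.

Lemma within_continuous_pair {T U V : topologicalType} (A : set T)
    (f : T -> U) (g : T -> V) :
  {within A, continuous f} -> {within A, continuous g} ->
  {within A, continuous (fun x => (f x, g x))}.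
Proof.
move=> /subspace_continuousP cf /subspace_continuousP cg.
apply/subspace_continuousP => x Ax.
by apply: cvg_pair; [exact: cf | exact: cg].
Qed.

Lemma continuous_pair {T U V : topologicalType} (f : T -> U) (g : T -> V) :
  continuous f -> continuous g -> continuous (fun x => (f x, g x)).
Proof. by move=> cf cg x; apply: cvg_pair; [exact: cf | exact: cg]. Qed.

Lemma within_continuous_cases {T U : topologicalType} {R : realType}
    (A : set T) (k : T -> R) (c : R) (f g : T -> U) :
  continuous k -> closed A ->
  {within A `&` [set x | k x <= c], continuous f} ->
  {within A `&` [set x | c <= k x], continuous g} ->
  (forall x, A x -> k x = c -> f x = g x) ->
  {within A, continuous (fun x => if k x <= c then f x else g x)}.
Proof.
move=> ck cA cf cg fg.
have -> : A = (A `&` [set x | k x <= c]) `|` (A `&` [set x | c <= k x]).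
  rewrite -setIUr; apply/seteqP; split => [x Ax|x []//]; split => //=.
  by case: (leP (k x) c) => [|/ltW]; [left|right].
have cl1 : closed [set x | k x <= c].
  by move: ((continuous_closedP k).1 ck) => /(_ _ (@closed_le R c)).
have cl2 : closed [set x | c <= k x].
  by move: ((continuous_closedP k).1 ck) => /(_ _ (@closed_ge R c)).
apply: withinU_continuous; try exact: closedI.
- by apply: within_continuous_eq cf => x [_ /= ->].
- apply: within_continuous_eq cg => x [Ax /= kx].
  case: ifP => // kx'; apply/esym/fg => //.
  by apply/eqP; rewrite eq_le kx kx'.
Qed.

End continuity.

Section loops.
Context {R : realType} {T : topologicalType}.

Notation I01 := (`[0, 1]%classic : set R).

Lemma in_I01 (t : R) : I01 t <-> 0 <= t <= 1.
Proof. by rewrite /= in_itv. Qed.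

Lemma closed_I01 : closed I01.
Proof. exact: itv_closed. Qed.

Lemma closed_I01X : closed (I01 `*` I01).
Proof.
rewrite (_ : _ `*` _ = (fst @^-1` I01) `&` (snd @^-1` I01)) //.
apply: closedI.
  have /continuous_closedP : continuous (@fst R R) by move=> z; exact: cvg_fst.
  by move=> /(_ _ closed_I01).
have /continuous_closedP : continuous (@snd R R) by move=> z; exact: cvg_snd.
by move=> /(_ _ closed_I01).
Qed.

(* A loop is given by a function on the whole line, of which only the values
   on [0, 1] are relevant. *)
Record loop (x : T) := Loop {
  loop_fun :> R -> T;
  loop_continuous : {within I01, continuous loop_fun};
  loop_start : loop_fun 0 = x;
  loop_end : loop_fun 1 = x }.

HB.instance Definition _ x := gen_eqMixin (loop x).
HB.instance Definition _ x := gen_choiceMixin (loop x).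

Definition loop_homotopic (x : T) (p q : loop x) : Prop :=
  exists H : R * R -> T,
    [/\ {within I01 `*` I01, continuous H},
        forall t, I01 t -> H (t, 0) = p t,
        forall t, I01 t -> H (t, 1) = q t &
        forall s, I01 s -> H (0, s) = x /\ H (1, s) = x].


Lemma continuous_affine (a b : R) : continuous (fun t : R => a * t + b).
Proof.
move=> t; apply: cvgD; last exact: cvg_cst.
by apply: cvgM; [exact: cvg_cst | exact: cvg_id].
Qed.

Lemma continuous_stage (a b c d : R) :
  continuous (fun z : R * R => (a * z.1 + b, c * z.2 + d)).
Proof.
apply: continuous_pair => z.
  by apply: (@continuous_comp _ _ _ fst (fun t => a * t + b));
    [exact: cvg_fst | exact: continuous_affine].
by apply: (@continuous_comp _ _ _ snd (fun t => c * t + d));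
  [exact: cvg_snd | exact: continuous_affine].
Qed.

Lemma reparam_homotopic (x : T) (g : R -> T) (u v : R -> R) (p q : loop x) :
  {within I01, continuous g} ->
  {within I01, continuous u} -> {within I01, continuous v} ->
  (forall t, I01 t -> I01 (u t)) -> (forall t, I01 t -> I01 (v t)) ->
  u 0 = v 0 -> u 1 = v 1 ->
  (forall t, I01 t -> p t = g (u t)) -> (forall t, I01 t -> q t = g (v t)) ->
  loop_homotopic p q.
Proof.
move=> cg cu cv uI vI uv0 uv1 pg qg.
have I0 : I01 0 by rewrite in_I01; lra.
have I1 : I01 1 by rewrite in_I01; lra.
have cfst : {within I01 `*` I01, continuous (fst : R * R -> R)}.
  by apply: continuous_within => z; exact: cvg_fst.
have csnd : {within I01 `*` I01, continuous (snd : R * R -> R)}.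
  by apply: continuous_within => z; exact: cvg_snd.
have cu1 : {within I01 `*` I01, continuous (u \o fst)}.
  by apply: within_continuous_comp_sub cfst _ cu => z [].
have cv1 : {within I01 `*` I01, continuous (v \o fst)}.
  by apply: within_continuous_comp_sub cfst _ cv => z [].
pose k (z : R * R) := (1 - z.2) * u z.1 + z.2 * v z.1.
exists (g \o k); split.
- apply: (within_continuous_comp_sub _ _ cg).
    apply/subspace_continuousP => z Az; apply: cvgD; apply: cvgM.
    + apply: cvgB; first exact: cvg_cst.
      by move/subspace_continuousP : csnd; exact.
    + by move/subspace_continuousP : cu1; exact.
    + by move/subspace_continuousP : csnd; exact.
    + by move/subspace_continuousP : cv1; exact.
  move=> [t s] [/= It Is]; rewrite in_itv /= /k /=.
  move: (uI _ It) (vI _ It) Is; rewrite /= !in_itv /=.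
  move=> /andP[u0 u1] /andP[v0 v1] /andP[s0 s1].
  have s0' : 0 <= 1 - s by lra.
  have uu1 : 0 <= 1 - u t by lra.
  have vv1 : 0 <= 1 - v t by lra.
  apply/andP; split; first by rewrite addr_ge0 ?mulr_ge0.
  have := mulr_ge0 s0' uu1; have := mulr_ge0 s0 vv1; lra.
- by move=> t It; rewrite /k /= subr0 mul1r mul0r addr0 pg.
- by move=> t It; rewrite /k /= subrr mul1r mul0r add0r qg.
- move=> s _; rewrite /k /= -uv0 -uv1 -!mulrDl subrK !mul1r -!pg //.
  by rewrite loop_start loop_end.
Qed.

Lemma loop_homotopic_refl (x : T) (p : loop x) : loop_homotopic p p.
Proof.
apply: (@reparam_homotopic x p id id) => //; first exact: loop_continuous.
- by apply: continuous_within => t; exact: cvg_id.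
- by apply: continuous_within => t; exact: cvg_id.
Qed.

Lemma loop_homotopic_sym (x : T) (p q : loop x) :
  loop_homotopic p q -> loop_homotopic q p.
Proof.
move=> [H [cH H0 H1 Hx]].
exists (H \o (fun z => (1 * z.1 + 0, (-1) * z.2 + 1))); split.
- apply: within_continuous_comp_sub cH.
    exact/continuous_within/continuous_stage.
  by move=> [t s] [/=]; rewrite !in_itv /= => *; split; lra.
- by move=> t It /=; rewrite mul1r mulr0 addr0 add0r H1.
- by move=> t It /=; rewrite mul1r mulr1 addr0 addNr H0.
- move=> s Is /=; rewrite mulr0 mulr1 !addr0; apply: Hx.
  by move: Is; rewrite !in_I01; lra.
Qed.

Lemma loop_homotopic_trans (x : T) (p q r : loop x) :
  loop_homotopic p q -> loop_homotopic q r -> loop_homotopic p r.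
Proof.
move=> [H [cH H0 H1 Hx]] [K [cK K0 K1 Kx]].
pose L (z : R * R) := if z.2 <= 2^-1
  then (H \o (fun z => (1 * z.1 + 0, 2 * z.2 + 0))) z
  else (K \o (fun z => (1 * z.1 + 0, 2 * z.2 + (-1)))) z.
exists L; split.
- apply: within_continuous_cases; first by move=> z; exact: cvg_snd.
  + exact: closed_I01X.
  + apply: within_continuous_comp_sub cH.
      exact/continuous_within/continuous_stage.
    by move=> [t s] [[/=]]; rewrite !in_itv /= => *; split; lra.
  + apply: within_continuous_comp_sub cK.
      exact/continuous_within/continuous_stage.
    by move=> [t s] [[/=]]; rewrite !in_itv /= => *; split; lra.
  + move=> [t s] [/= It Is] ->; rewrite mul1r !addr0 divff ?pnatr_eq0 //.
    by rewrite subrr H1 // K0.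
- by move=> t It; rewrite /L /= ifT ?mul1r ?mulr0 ?addr0 ?H0 //; lra.
- move=> t It; rewrite /L /= ifF; last by apply/negbTE; lra.
  by rewrite mul1r addr0 (_ : 2 * 1 + -1 = 1) ?K1 //; lra.
- move=> s; rewrite in_I01 => Is; rewrite /L /=.
  rewrite !mulr0 !mulr1 !addr0; case: ifP => hs.
    by apply: Hx; rewrite in_I01; lra.
  by apply: Kx; rewrite in_I01; lra.
Qed.

Definition loop_equiv (x : T) : rel (loop x) :=
  fun p q => `[< loop_homotopic p q >].

Lemma loop_equiv_refl x : reflexive (@loop_equiv x).
Proof. by move=> p; apply/asboolP; exact: loop_homotopic_refl. Qed.

Lemma loop_equiv_sym x : symmetric (@loop_equiv x).
Proof.
by move=> p q; apply/asboolP/asboolP; exact: loop_homotopic_sym.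
Qed.

Lemma loop_equiv_trans x : transitive (@loop_equiv x).
Proof.
move=> q p r /asboolP pq /asboolP qr; apply/asboolP.
exact: loop_homotopic_trans pq qr.
Qed.

Canonical loop_equiv_equiv x := EquivRel (@loop_equiv x)
  (@loop_equiv_refl x) (@loop_equiv_sym x) (@loop_equiv_trans x).

Lemma continuous_loop_cst x : {within I01, continuous (cst x : R -> T)}.
Proof. by apply: continuous_within => t; exact: cvg_cst. Qed.

Definition loop_cst (x : T) : loop x :=
  @Loop x (cst x) (@continuous_loop_cst x) erefl erefl.

Lemma loop_rev_continuous x (p : loop x) :
  {within I01, continuous (fun t => p ((-1) * t + 1))}.
Proof.
apply: (@within_continuous_comp_sub _ _ _ I01 I01
  (fun t => (-1) * t + 1) p); last exact: loop_continuous.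
  exact/continuous_within/continuous_affine.
by move=> t; rewrite !in_I01; lra.
Qed.

Lemma loop_rev_start x (p : loop x) : p ((-1) * 0 + 1) = x.
Proof. by rewrite mulr0 add0r loop_end. Qed.

Lemma loop_rev_end x (p : loop x) : p ((-1) * 1 + 1) = x.
Proof. by rewrite mulr1 addNr loop_start. Qed.

Definition loop_rev x (p : loop x) : loop x :=
  Loop (@loop_rev_continuous x p) (loop_rev_start p) (loop_rev_end p).

Definition loop_cat_fun x (p q : loop x) (t : R) : T :=
  if t <= 2^-1 then p (2 * t) else q (2 * t - 1).

Lemma loop_cat_continuous x (p q : loop x) :
  {within I01, continuous (loop_cat_fun p q)}.
Proof.
apply: (within_continuous_cases (k := id));
  [by move=> t; exact: cvg_id | exact: closed_I01 | | |].
- apply: (@within_continuous_comp_sub _ _ _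
    (I01 `&` [set t | t <= 2^-1]) I01 (fun t => 2 * t) p);
  last exact: loop_continuous.
    apply: continuous_within => t.
    by apply: cvgM; [exact: cvg_cst | exact: cvg_id].
  by move=> t; rewrite !in_I01 /= in_itv /= => -[]; lra.
- apply: (@within_continuous_comp_sub _ _ _
    (I01 `&` [set t | 2^-1 <= t]) I01 (fun t => 2 * t + (-1)) q);
  last exact: loop_continuous.
    exact/continuous_within/continuous_affine.
  by move=> t; rewrite !in_I01 /= in_itv /= => -[]; lra.
- by move=> t _ ->; rewrite divff ?pnatr_eq0 // subrr loop_start loop_end.
Qed.

Lemma loop_cat_start x (p q : loop x) : loop_cat_fun p q 0 = x.
Proof. by rewrite /loop_cat_fun ifT ?mulr0 ?loop_start //; lra. Qed.

Lemma loop_cat_end x (p q : loop x) : loop_cat_fun p q 1 = x.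
Proof.
rewrite /loop_cat_fun ifF; last by apply/negbTE; lra.
by rewrite (_ : 2 * 1 - 1 = 1) ?loop_end //; lra.
Qed.

Definition loop_cat x (p q : loop x) : loop x :=
  Loop (@loop_cat_continuous x p q) (loop_cat_start p q) (loop_cat_end p q).

Lemma loop_cat_homotopic x (p p' q q' : loop x) :
  loop_homotopic p p' -> loop_homotopic q q' ->
  loop_homotopic (loop_cat p q) (loop_cat p' q').
Proof.
move=> [H [cH H0 H1 Hx]] [K [cK K0 K1 Kx]].
have I0 : I01 0 by rewrite in_I01; lra.
have I1 : I01 1 by rewrite in_I01; lra.
pose L (z : R * R) := if z.1 <= 2^-1
  then (H \o (fun z => (2 * z.1 + 0, 1 * z.2 + 0))) z
  else (K \o (fun z => (2 * z.1 + (-1), 1 * z.2 + 0))) z.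
exists L; split.
- apply: within_continuous_cases; first by move=> z; exact: cvg_fst.
  + exact: closed_I01X.
  + apply: within_continuous_comp_sub cH.
      exact/continuous_within/continuous_stage.
    by move=> [t s] [[/=]]; rewrite !in_itv /= => *; split; lra.
  + apply: within_continuous_comp_sub cK.
      exact/continuous_within/continuous_stage.
    by move=> [t s] [[/=]]; rewrite !in_itv /= => *; split; lra.
  + move=> [t s] [/= It Is] ->; rewrite mul1r !addr0 divff ?pnatr_eq0 // subrr.
    by rewrite (Hx _ Is).2 (Kx _ Is).1.
- move=> t; rewrite in_I01 => It; rewrite /L /= /loop_cat_fun mul1r !addr0.
  by case: ifP => ht; rewrite ?H0 ?K0 // in_I01; lra.
- move=> t; rewrite in_I01 => It; rewrite /L /= /loop_cat_fun mul1r !addr0.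
  by case: ifP => ht; rewrite ?H1 ?K1 // in_I01; lra.
- move=> s Is; rewrite /L /= mul1r !addr0 mulr0 ifT ?(Hx _ Is).1; last lra.
  rewrite ifF; last by apply/negbTE; lra.
  by rewrite (_ : 2 * 1 + -1 = 1) ?(Kx _ Is).2 //; lra.
Qed.

Lemma loop_rev_homotopic x (p q : loop x) :
  loop_homotopic p q -> loop_homotopic (loop_rev p) (loop_rev q).
Proof.
move=> [H [cH H0 H1 Hx]].
exists (H \o (fun z => ((-1) * z.1 + 1, 1 * z.2 + 0))); split.
- apply: within_continuous_comp_sub cH.
    exact/continuous_within/continuous_stage.
  by move=> [t s] [/=]; rewrite !in_itv /= => *; split; lra.
- move=> t; rewrite in_I01 => It /=; rewrite mulr0 addr0 H0 // in_I01; lra.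
- move=> t; rewrite in_I01 => It /=; rewrite mulr1 addr0 H1 // in_I01; lra.
- by move=> s Is /=; rewrite mulr0 mulr1 add0r addNr mul1r addr0;
    have [] := Hx _ Is.
Qed.

Lemma loop_catA x (p q r : loop x) : loop_homotopic
  (loop_cat p (loop_cat q r)) (loop_cat (loop_cat p q) r).
Proof.
pose u (t : R) : R := if t <= 4^-1 then 2 * t + 0
  else if t <= 2^-1 then 1 * t + 4^-1 else 2^-1 * t + 2^-1.
have cu : {within I01, continuous u}.
  apply: (within_continuous_cases (k := id));
  [by move=> t; exact: cvg_id | exact: closed_I01 | | |].
  - exact/continuous_within/continuous_affine.
  - apply: (within_continuous_cases (k := id)).
    + by move=> t; exact: cvg_id.
    + by apply: closedI; [exact: closed_I01 | exact: closed_ge].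
    + exact/continuous_within/continuous_affine.
    + exact/continuous_within/continuous_affine.
    + by move=> t _ ->; lra.
  - by move=> t _ ->; rewrite ifT; lra.
apply: loop_homotopic_sym.
apply: (@reparam_homotopic x (loop_cat p (loop_cat q r)) u id) => //.
- exact: loop_continuous.
- by apply: continuous_within => t; exact: cvg_id.
- move=> t; rewrite !in_I01 /u => It.
  by case: (leP t 4^-1) => h1; [lra | case: (leP t 2^-1) => h2; lra].
- by rewrite /u ifT; lra.
- by rewrite /u ifF ?ifF; [lra | apply/negbTE; lra..].
- move=> t; rewrite in_I01 => It; rewrite /= /loop_cat_fun /= /loop_cat_fun /u.
  case: (leP t 4^-1) => h1; first by rewrite !ifT; [congr (p _); lra | lra..].
  case: (leP t 2^-1) => h2.
    rewrite ifF; last by apply/negbTE; lra.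
    rewrite ifF; last by apply/negbTE; lra.
    by rewrite ifT; [congr (q _); lra | lra].
  rewrite ifF; last by apply/negbTE; lra.
  rewrite ifF; last by apply/negbTE; lra.
  by congr (r _); lra.
Qed.

Lemma loop_cat1l x (p : loop x) : loop_homotopic (loop_cat (loop_cst x) p) p.
Proof.
pose u (t : R) : R := if t <= 2^-1 then 0 * t + 0 else 2 * t + (-1).
apply: (@reparam_homotopic x p u id) => //.
- exact: loop_continuous.
- apply: (within_continuous_cases (k := id));
  [by move=> t; exact: cvg_id | exact: closed_I01 | | |].
  + exact/continuous_within/continuous_affine.
  + exact/continuous_within/continuous_affine.
  + by move=> t _ ->; lra.
- by apply: continuous_within => t; exact: cvg_id.
- by move=> t; rewrite !in_I01 /u => It; case: (leP t 2^-1) => h; lra.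
- by rewrite /u ifT; lra.
- by rewrite /u ifF; [lra | apply/negbTE; lra].
- move=> t _; rewrite /= /loop_cat_fun /u /=; case: ifP => // _.
  by rewrite mul0r addr0 loop_start.
Qed.

Lemma loop_cat1r x (p : loop x) : loop_homotopic (loop_cat p (loop_cst x)) p.
Proof.
pose u (t : R) : R := if t <= 2^-1 then 2 * t + 0 else 0 * t + 1.
apply: (@reparam_homotopic x p u id) => //.
- exact: loop_continuous.
- apply: (within_continuous_cases (k := id));
  [by move=> t; exact: cvg_id | exact: closed_I01 | | |].
  + exact/continuous_within/continuous_affine.
  + exact/continuous_within/continuous_affine.
  + by move=> t _ ->; lra.
- by apply: continuous_within => t; exact: cvg_id.
- by move=> t; rewrite !in_I01 /u => It; case: (leP t 2^-1) => h; lra.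
- by rewrite /u ifT; lra.
- by rewrite /u ifF; [lra | apply/negbTE; lra].
- move=> t _; rewrite /= /loop_cat_fun /u /=; case: ifP => _.
    by rewrite addr0.
  by rewrite mul0r add0r loop_end.
Qed.

Lemma loop_catV x (p : loop x) :
  loop_homotopic (loop_cat p (loop_rev p)) (loop_cst x).
Proof.
pose u (t : R) : R := if t <= 2^-1 then 2 * t + 0 else (-2) * t + 2.
apply: (@reparam_homotopic x p u (cst 0)) => //.
- exact: loop_continuous.
- apply: (within_continuous_cases (k := id));
  [by move=> t; exact: cvg_id | exact: closed_I01 | | |].
  + exact/continuous_within/continuous_affine.
  + exact/continuous_within/continuous_affine.
  + by move=> t _ ->; lra.
- by apply: continuous_within => t; exact: cvg_cst.
- by move=> t; rewrite !in_I01 /u => It; case: (leP t 2^-1) => h; lra.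
- by move=> t _; rewrite in_I01 /cst /= lexx ler01.
- by rewrite /u /cst ifT; lra.
- by rewrite /u /cst ifF; [lra | apply/negbTE; lra].
- move=> t _; rewrite /= /loop_cat_fun /u /=; case: ifP => _.
    by rewrite addr0.
  by congr (p _); lra.
- by move=> t _; rewrite /= loop_start.
Qed.

Lemma loop_catVl x (p : loop x) :
  loop_homotopic (loop_cat (loop_rev p) p) (loop_cst x).
Proof.
pose u (t : R) : R := if t <= 2^-1 then (-2) * t + 1 else 2 * t + (-1).
apply: (@reparam_homotopic x p u (cst 1)) => //.
- exact: loop_continuous.
- apply: (within_continuous_cases (k := id));
  [by move=> t; exact: cvg_id | exact: closed_I01 | | |].
  + exact/continuous_within/continuous_affine.
  + exact/continuous_within/continuous_affine.
  + by move=> t _ ->; lra.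
- by apply: continuous_within => t; exact: cvg_cst.
- by move=> t; rewrite !in_I01 /u => It; case: (leP t 2^-1) => h; lra.
- by move=> t _; rewrite in_I01 /cst /= lexx ler01.
- by rewrite /u /cst ifT; lra.
- by rewrite /u /cst ifF; [lra | apply/negbTE; lra].
- move=> t _; rewrite /= /loop_cat_fun /u /=; case: ifP => _ //.
  by congr (p _); lra.
- by move=> t _; rewrite /= loop_end.
Qed.

End loops.

Arguments loop R {T} x.
Arguments loop_equiv_equiv R {T} x.
Arguments loop_cst R {T} x.

Section fundamental_group.
Context (R : realType) (T : topologicalType) (x : T).
Local Open Scope quotient_scope.

Definition pi1 := {eq_quot (loop_equiv_equiv R x)}.

HB.instance Definition _ := Choice.on pi1.
HB.instance Definition _ := EqQuotient.on pi1.

Definition loop_class (p : loop R x) : pi1 := \pi p.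

Lemma loop_classP (p q : loop R x) :
  loop_class p = loop_class q <-> loop_homotopic p q.
Proof. by split => [/eqmodP/asboolP|h] //; apply/eqmodP/asboolP. Qed.

Definition pi1_mul (a b : pi1) : pi1 :=
  loop_class (loop_cat (repr a) (repr b)).
Definition pi1_one : pi1 := loop_class (loop_cst R x).
Definition pi1_inv (a : pi1) : pi1 := loop_class (loop_rev (repr a)).

Lemma loop_class_repr (a : pi1) : loop_class (repr a) = a.
Proof. exact: reprK. Qed.

Lemma pi1_mulE (p q : loop R x) :
  pi1_mul (loop_class p) (loop_class q) = loop_class (loop_cat p q).
Proof.
by apply/loop_classP/loop_cat_homotopic; apply/loop_classP;
  rewrite loop_class_repr.
Qed.

Lemma pi1_invE (p : loop R x) :
  pi1_inv (loop_class p) = loop_class (loop_rev p).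
Proof.
by apply/loop_classP/loop_rev_homotopic; apply/loop_classP;
  rewrite loop_class_repr.
Qed.

Lemma pi1_mulA : associative pi1_mul.
Proof.
move=> a b c; rewrite -(loop_class_repr a) -(loop_class_repr b).
by rewrite -(loop_class_repr c) !pi1_mulE; apply/loop_classP/loop_catA.
Qed.

Lemma pi1_mul1 : left_id pi1_one pi1_mul.
Proof.
by move=> a; rewrite -(loop_class_repr a) pi1_mulE;
  apply/loop_classP/loop_cat1l.
Qed.

Lemma pi1_mulr1 : right_id pi1_one pi1_mul.
Proof.
by move=> a; rewrite -(loop_class_repr a) pi1_mulE;
  apply/loop_classP/loop_cat1r.
Qed.

Lemma pi1_mulV : left_inverse pi1_one pi1_inv pi1_mul.
Proof.
move=> a; rewrite -(loop_class_repr a) pi1_invE pi1_mulE.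
exact/loop_classP/loop_catVl.
Qed.

Lemma pi1_mulrV : right_inverse pi1_one pi1_inv pi1_mul.
Proof.
move=> a; rewrite -(loop_class_repr a) pi1_invE pi1_mulE.
exact/loop_classP/loop_catV.
Qed.

HB.instance Definition _ := isGroup.Build pi1
  pi1_mulA pi1_mul1 pi1_mulr1 pi1_mulV pi1_mulrV.

End fundamental_group.

Section induced_map.
Context (R : realType) (T U : topologicalType) (f : T -> U).
Context (f_continuous : continuous f) (x : T).

Lemma loop_map_continuous (p : loop R x) :
  {within `[0, 1]%classic, continuous (f \o p)}.
Proof.
apply: (@within_continuous_comp_sub _ _ _ _ setT p f) => //.
  exact: loop_continuous.
exact: continuous_within.
Qed.

Lemma loop_map_start (p : loop R x) : (f \o p) 0 = f x.
Proof. by rewrite /= loop_start. Qed.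

Lemma loop_map_end (p : loop R x) : (f \o p) 1 = f x.
Proof. by rewrite /= loop_end. Qed.

Definition loop_map (p : loop R x) : loop R (f x) :=
  Loop (@loop_map_continuous p) (loop_map_start p) (loop_map_end p).

Lemma loop_map_homotopic (p q : loop R x) :
  loop_homotopic p q -> loop_homotopic (loop_map p) (loop_map q).
Proof.
move=> [H [cH H0 H1 Hx]]; exists (f \o H); split.
- apply: (@within_continuous_comp_sub _ _ _ _ setT H f) => //.
  exact: continuous_within.
- by move=> t /H0 /= ->.
- by move=> t /H1 /= ->.
- by move=> s /Hx /= [-> ->].
Qed.

Local Open Scope quotient_scope.

Definition pi1_map (a : pi1 R x) : pi1 R (f x) :=
  loop_class (loop_map (repr a)).

Lemma pi1_mapE (p : loop R x) :
  pi1_map (loop_class p) = loop_class (loop_map p).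
Proof.
by apply/loop_classP/loop_map_homotopic; apply/loop_classP;
  rewrite loop_class_repr.
Qed.

End induced_map.

Definition group_isomorphism (G H : groupType) (f : G -> H) : Prop :=
  {morph f : a b / (a * b)%g >-> (a * b)%g} /\ bijective f.

Definition homotopic (R : realType) (T U : topologicalType) (f g : T -> U) :=
  exists H : T * R -> U,
    [/\ {within setT `*` `[0, 1]%classic, continuous H},
        forall x, H (x, 0) = f x &
        forall x, H (x, 1) = g x].

Definition homotopy_equivalence (R : realType) (T U : topologicalType)
    (f : T -> U) :=
  continuous f /\ exists g : U -> T,
    [/\ continuous g, homotopic R (g \o f) id & homotopic R (f \o g) id].

Definition embedding_on (T U : topologicalType) (D : set T) (f : T -> U) :=
  [/\ set_inj D f, {within D, continuous f} &
      forall O : set T, open O ->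
        exists2 V : set U, open V & f @` (D `&` O) = f @` D `&` V].

Definition quotient_map (T U : topologicalType) (f : T -> U) :=
  range f = setT /\ forall V : set U, open V <-> open (f @^-1` V).

(* A two-dimensional manifold, possibly disconnected and with boundary. *)
Definition surface (R : realType) (Z : topologicalType) :=
  [/\ hausdorff_space Z, @second_countable Z &
      forall z : Z, exists (U : set Z) (f : Z -> R * R),
        [/\ open U, U z, embedding_on U f &
            exists2 V : set (R * R), open V &
              f @` U = V `&` [set p | 0 <= p.2]]].

Section strips.
Context {R : realType}.
Implicit Types S : set (R * R).

Definition model_strip S :=
  [/\ S `<=` [set p | -1 <= p.2 <= 1],
      [set p | -1 < p.2 < 1] `<=` S &
      forall e : R, e = -1 \/ e = 1 ->
        exists F : set (set R),
          [/\ countable F, trivIset F id,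
              forall J, F J -> open J /\ is_interval J &
              [set x | S (x, e)] = \bigcup_(J in F) J]].

Definition strip_boundary S : set (R * R) :=
  S `&` [set p | p.2 = -1 \/ p.2 = 1].

Definition boundary_interval S (J : set (R * R)) :=
  exists2 p, strip_boundary S p & J = connected_component (strip_boundary S) p.

Lemma boundary_interval_sub S (J : set (R * R)) :
  boundary_interval S J -> J `<=` strip_boundary S.
Proof. by move=> [p _ ->]; exact: connected_component_sub. Qed.

Definition strip_space S : topologicalType := set_type S.

Lemma model_strip_origin S : model_strip S -> (0, 0) \in S.
Proof. by move=> [_ inS _]; rewrite inE; apply: inS => /=; lra. Qed.

(* Points and subsets of the disjoint union of strips are given by an index
   and a point (resp. a subset) of the plane. *)
Definition strips (A : choiceType) (S : A -> set (R * R)) : topologicalType :=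
  {a : A & strip_space (S a)}.

Definition coords (A : choiceType) (S : A -> set (R * R)) (p : strips S) :
  R * R := \val (projT2 p).

Definition in_strip (A : choiceType) (S : A -> set (R * R)) (a : A)
    (J : set (R * R)) : set (strips S) :=
  [set p | projT1 p = a /\ J (coords p)].

End strips.

Record striped_atlas (R : realType) (Z : topologicalType) := StripedAtlas {
  strip_index : choiceType;
  strip : strip_index -> set (R * R);
  strip_index_countable : countable [set: strip_index];
  stripP : forall a, model_strip (strip a);
  atlas_map : strips strip -> Z;
  atlas_map_quotient : quotient_map atlas_map;
  seam_index : choiceType;
  (* X_b is the interval [Xint b] of the boundary of the strip number [Xidx b],
     and similarly for Y_b. *)
  Xidx : seam_index -> strip_index;
  Xint : seam_index -> set (R * R);
  Yidx : seam_index -> strip_index;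
  Yint : seam_index -> set (R * R);
  familyX := fun b => in_strip (Xidx b) (Xint b) : set (strips strip);
  familyY := fun b => in_strip (Yidx b) (Yint b) : set (strips strip);
  glued := \bigcup_b (familyX b `|` familyY b);
  Xint_boundary : forall b, boundary_interval (strip (Xidx b)) (Xint b);
  Yint_boundary : forall b, boundary_interval (strip (Yidx b)) (Yint b);
  families_disjoint : forall b b', familyX b <> familyY b';
  atlas_map_inj : set_inj (~` glued) atlas_map;
  atlas_map_XY : forall b, atlas_map @` familyX b = atlas_map @` familyY b;
  atlas_map_X_embedding : forall b, embedding_on (familyX b) atlas_map;
  atlas_map_Y_embedding : forall b, embedding_on (familyY b) atlas_map;
  atlas_map_X_disjoint : forall b b', b <> b' ->
    atlas_map @` familyX b `&` atlas_map @` familyX b' = set0;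
  atlas_map_X_glued : forall b,
    atlas_map @` familyX b `&` atlas_map @` (~` glued) = set0
}.

Section graph.
Context {R : realType} {Z : topologicalType} (At : striped_atlas R Z).
Local Open Scope quotient_scope.

(* The disjoint union of the vertices and of the edges [-1, 1]. *)
Definition cell (i : strip_index At + seam_index At) : topologicalType :=
  match i with
  | inl _ => discrete_topology unit
  | inr _ => set_type (`[-1, 1]%classic : set R)
  end.

Definition cells : topologicalType :=
  {i : strip_index At + seam_index At & cell i}.

Definition vertex_cell (a : strip_index At) : cells := existT cell (inl a) tt.

Definition edge_cell (b : seam_index At) (t : `[-1, 1]%classic : set R) :
  cells :=
  existT cell (inr b) t.

(* Replaces the ends of an edge by the vertices they are attached to. *)
Definition attach (p : cells) : cells :=
  match p with
  | existT (inl a) _ => vertex_cell a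
  | existT (inr b) t =>
      if \val t == -1 :> R then vertex_cell (Xidx b)
      else if \val t == 1 :> R then vertex_cell (Yidx b)
      else edge_cell b t
  end.

Definition attach_rel : rel cells := fun p p' => attach p == attach p'.

Lemma attach_rel_refl : reflexive attach_rel.
Proof. by move=> p; rewrite /attach_rel. Qed.

Lemma attach_rel_sym : symmetric attach_rel.
Proof. by move=> p p'; rewrite /attach_rel eq_sym. Qed.

Lemma attach_rel_trans : transitive attach_rel.
Proof. by move=> p p' p''; rewrite /attach_rel => /eqP -> /eqP ->. Qed.

Canonical attach_equiv :=
  EquivRel attach_rel attach_rel_refl attach_rel_sym attach_rel_trans.

Definition graph := {eq_quot attach_equiv}.

HB.instance Definition _ := Topological.copy graph (quotient_topology graph).
HB.instance Definition _ := Quotient.on graph.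

Definition vertex (a : strip_index At) : graph := \pi_graph (vertex_cell a).

Definition edge (b : seam_index At) (t : `[-1, 1]%classic : set R) : graph :=
  \pi_graph (edge_cell b t).

End graph.

Section canonical_map.
Context {R : realType} {Z : topologicalType} (At : striped_atlas R Z).

Definition seam (b : seam_index At) : set Z := @atlas_map R Z At @` familyX b.

Record seam_points := SeamPoints {
  seam_point :> seam_index At -> Z;
  seam_pointP : forall b, seam b (seam_point b) }.

Context (z : seam_points).

Lemma seam_pointYP b : (@atlas_map R Z At @` familyY b) (z b).
Proof. by rewrite -atlas_map_XY; exact: seam_pointP. Qed.

(* The coordinates (x_b, e) and (y_b, e') of the points of X_b and Y_b that lie
   over z_b. *)
Definition xpoint (b : seam_index At) : R * R :=
  coords (projT1 (cid2 (seam_pointP z b))).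

Definition ypoint (b : seam_index At) : R * R :=
  coords (projT1 (cid2 (seam_pointYP b))).

Definition origin (a : strip_index At) : strip_space (strip a) :=
  exist _ (0, 0) (model_strip_origin (stripP a)).

(* The point of the strip number [a] with given coordinates; it is the origin of
   the strip if these coordinates lie outside the strip. *)
Definition strip_point (a : strip_index At) (p : R * R) :
  strips (@strip R Z At) :=
  existT (fun a => strip_space (strip a)) a (insubd (origin a) p).

Definition edge_map (b : seam_index At) (t : R) : Z :=
  let: (x, e) := xpoint b in
  let: (y, e') := ypoint b in
  let a := Xidx b in
  let a' := Yidx b in
  if t <= - 2^-1 then atlas_map (strip_point a (2 * (1 + t) * x, (1 + t) * e))
  else if t <= 0 then atlas_map (strip_point a (x, (1 + t) * e))
  else if t <= 2^-1 then atlas_map (strip_point a' (y, (1 - t) * e'))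
  else atlas_map (strip_point a' (2 * (1 - t) * y, (1 - t) * e')).

Definition cells_map (p : cells At) : Z :=
  match p with
  | existT (inl a) _ => atlas_map (strip_point a (0, 0))
  | existT (inr b) t => edge_map b (\val t)
  end.

Definition graph_map : graph At -> Z := cells_map \o repr.

Lemma strip_pointK (a : strip_index At) (u : strip_space (strip a)) :
  strip_point a (\val u) = existT (fun a => strip_space (strip a)) a u.
Proof. by rewrite /strip_point valKd. Qed.

Lemma coords_strip_point (a : strip_index At) (p : R * R) :
  strip a p -> coords (strip_point a p) = p.
Proof. by move=> Sp; rewrite /coords /= insubdK //; exact/mem_set. Qed.

Lemma strip_point_coords (p : strips (@strip R Z At)) :
  strip_point (projT1 p) (coords p) = p.
Proof. by case: p => a u; rewrite /coords /= strip_pointK. Qed.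

Lemma strip_coords (p : strips (@strip R Z At)) : strip (projT1 p) (coords p).
Proof. exact: set_valP. Qed.

Lemma in_strip_boundary (a : strip_index At) (J : set (R * R))
    (p : strips (@strip R Z At)) :
  boundary_interval (strip a) J -> in_strip a J p ->
  [/\ J (coords p), strip a (coords p), strip_point a (coords p) = p &
      (coords p).2 = -1 \/ (coords p).2 = 1].
Proof.
move=> /boundary_interval_sub JS [<- Jp]; split => //.
- exact: strip_coords.
- exact: strip_point_coords.
- by have [_] := JS _ Jp.
Qed.

Lemma xpointP b :
  [/\ Xint b (xpoint b), strip (Xidx b) (xpoint b),
      atlas_map (strip_point (Xidx b) (xpoint b)) = z b &
      (xpoint b).2 = -1 \/ (xpoint b).2 = 1].
Proof.
rewrite /xpoint; case: cid2 => p Xp qp /=.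
have [Jp Sp pE e1] := in_strip_boundary (Xint_boundary b) Xp.
by split => //; rewrite pE.
Qed.

Lemma ypointP b :
  [/\ Yint b (ypoint b), strip (Yidx b) (ypoint b),
      atlas_map (strip_point (Yidx b) (ypoint b)) = z b &
      (ypoint b).2 = -1 \/ (ypoint b).2 = 1].
Proof.
rewrite /ypoint; case: cid2 => p Yp qp /=.
have [Jp Sp pE e1] := in_strip_boundary (Yint_boundary b) Yp.
by split => //; rewrite pE.
Qed.

Lemma strip_interior (a : strip_index At) (p : R * R) :
  -1 < p.2 < 1 -> strip a p.
Proof. by move=> p1; have [_ + _] := stripP a; exact. Qed.

Lemma strip_segment (a : strip_index At) (x e s : R) :
  strip a (x, e) -> e = -1 \/ e = 1 -> 0 <= s <= 1 -> strip a (x, s * e).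
Proof.
move=> Sx he /andP[s0 s1]; have [s1'|] := ltP s 1; last first.
  by move=> s1'; rewrite (_ : s = 1) ?mul1r//; apply/eqP; rewrite eq_le s1.
by apply: strip_interior => /=; case: he => ->; lra.
Qed.

Lemma atlas_map_continuous : continuous (@atlas_map R Z At).
Proof.
by apply/continuousP => V; have [_ qP] := atlas_map_quotient At; move/qP.
Qed.

Lemma strip_point_continuous (a : strip_index At) :
  {within strip a, continuous (strip_point a)}.
Proof.
apply/subspace_sigL_continuousP.
rewrite (_ : sigL _ _ = existT (fun a => strip_space (strip a)) a).
  by move=> u U HU; exact: HU.
by apply/funext => u; rewrite /sigL /= -strip_pointK set_valE.
Qed.

Lemma edge_piece_continuous (D : set R) (a : strip_index At) (c : R -> R * R) :
  continuous c -> (forall t, D t -> strip a (c t)) ->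
  {within D, continuous (fun t => atlas_map (strip_point a (c t)))}.
Proof.
move=> cc cS.
apply: (@within_continuous_comp_sub _ _ _ D setT
  (strip_point a \o c) (@atlas_map R Z At)) => //; last first.
  exact/continuous_within/atlas_map_continuous.
apply: (@within_continuous_comp_sub _ _ _ D (strip a) c) => //.
  exact: continuous_within.
exact: strip_point_continuous.
Qed.

Let continuous_prod (a1 b1 a2 b2 c d : R) : continuous (fun t : R =>
  ((a1 * t + b1) * c, (a2 * t + b2) * d)).
Proof.
apply: continuous_pair => t; apply: cvgM.
- exact: continuous_affine.
- exact: cvg_cst.
- exact: continuous_affine.
- exact: cvg_cst.
Qed.

Lemma edge_map_continuous b :
  {within `[-1, 1]%classic, continuous (edge_map b)}.
Proof.
rewrite /edge_map; have [_] := xpointP b; have [_] := ypointP b.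
case: (ypoint b) (xpoint b) => y e' [x e] /= Sy qy he' Sx qx he.
have cR : continuous (id : R -> R) by move=> t; exact: cvg_id.
have cle (D : set R) (c : R) : closed D -> closed (D `&` [set t | c <= t]).
  by move=> cD; apply: closedI => //; exact: closed_ge.
have cI : closed (`[-1, 1]%classic : set R) by exact: itv_closed.
have inS (a : strip_index At) (D : set R) (f : R -> R) (k : R -> R) (w d : R) :
  d = -1 \/ d = 1 -> (forall t, D t -> 0 <= k t <= 2^-1) ->
  forall t, D t -> strip a (f t * w, k t * d).
  move=> hd hk t /hk kt; apply: strip_interior => /=.
  by case: hd => ->; lra.
apply: (within_continuous_cases (k := id)) => //.
- rewrite (_ : (fun _ => _) = fun t => atlas_map (strip_point (Xidx b)
    ((2 * t + 2) * x, (1 * t + 1) * e))); last first.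
    by apply/funext => t; congr (atlas_map (strip_point _ (_, _))); lra.
  apply: edge_piece_continuous; first exact: continuous_prod.
  by apply: (inS _ _ (fun t => 2 * t + 2) (fun t => 1 * t + 1)) => // t [];
    rewrite /= in_itv /=; lra.
- apply: (within_continuous_cases (k := id)) => //; first exact: cle.
  + rewrite (_ : (fun _ => _) = fun t => atlas_map (strip_point (Xidx b)
      ((0 * t + 1) * x, (1 * t + 1) * e))); last first.
      by apply/funext => t; congr (atlas_map (strip_point _ (_, _))); lra.
    apply: edge_piece_continuous; first exact: continuous_prod.
    move=> t [[]]; rewrite /= in_itv /= => h1 h2 h3.
    by rewrite mul0r add0r !mul1r; apply: strip_segment => //; lra.
  + apply: (within_continuous_cases (k := id)) => //.
      exact/(cle _ _ (cle _ _ cI)).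
    * rewrite (_ : (fun _ => _) = fun t => atlas_map (strip_point (Yidx b)
        ((0 * t + 1) * y, ((-1) * t + 1) * e'))); last first.
        by apply/funext => t; congr (atlas_map (strip_point _ (_, _))); lra.
      apply: edge_piece_continuous; first exact: continuous_prod.
      move=> t [[[]]]; rewrite /= in_itv /= => h1 h2 h3 h4.
      by rewrite mul0r add0r !mul1r; apply: strip_segment => //; lra.
    * rewrite (_ : (fun _ => _) = fun t => atlas_map (strip_point (Yidx b)
        (((-2) * t + 2) * y, ((-1) * t + 1) * e'))); last first.
        by apply/funext => t; congr (atlas_map (strip_point _ (_, _))); lra.
      apply: edge_piece_continuous; first exact: continuous_prod.
      apply: (inS _ _ (fun t => (-2) * t + 2) (fun t => (-1) * t + 1)) => //.
      by move=> t [[[]]]; rewrite /= in_itv /=; lra.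
    * by move=> t _ /= ->; congr (atlas_map (strip_point _ (_, _))); lra.
  + move=> t _ /= ->; rewrite ifT ?invr_ge0 //.
    by rewrite addr0 subr0 !mul1r qx qy.
- move=> t _ /= ->; rewrite ifT ?oppr_le0 ?invr_ge0 //.
  by congr (atlas_map (strip_point _ (_, _))); lra.
Qed.

Lemma edge_map_start b :
  edge_map b (-1) = atlas_map (strip_point (Xidx b) (0, 0)).
Proof.
rewrite /edge_map; case: (xpoint b) (ypoint b) => x e [y e'].
rewrite ifT; last lra.
by congr (atlas_map (strip_point _ (_, _))); lra.
Qed.

Lemma edge_map_end b : edge_map b 1 = atlas_map (strip_point (Yidx b) (0, 0)).
Proof.
rewrite /edge_map; case: (xpoint b) (ypoint b) => x e [y e'].
rewrite !ifF; try by apply/negbTE; lra.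
by congr (atlas_map (strip_point _ (_, _))); lra.
Qed.

Lemma cells_map_attach p : cells_map (attach p) = cells_map p.
Proof.
case: p => -[a u|b t] //=; case: eqP => [->|_].
  by rewrite edge_map_start.
by case: eqP => [->|_] //; rewrite edge_map_end.
Qed.

Lemma cells_map_continuous : continuous cells_map.
Proof.
move=> [[a|b] u] U HU.
  exact: (@cvg_cst _ (cells_map (vertex_cell a)) _ (nbhs u)).
have /subspace_sigL_continuousP/(_ u U) := @edge_map_continuous b.
exact.
Qed.

Local Open Scope quotient_scope.

Lemma graph_map_pi (p : cells At) : graph_map (\pi_(graph At) p) = cells_map p.
Proof.
rewrite /graph_map /=; case: piP => p' /eqmodP /eqP pp'.
by rewrite -cells_map_attach -pp' cells_map_attach.
Qed.

Lemma graph_map_vertex a :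
  graph_map (vertex a) = atlas_map (strip_point a (0, 0)).
Proof. by rewrite graph_map_pi. Qed.

Lemma graph_map_edge b (t : `[-1, 1]%classic : set R) :
  graph_map (edge b t) = edge_map b (\val t).
Proof. by rewrite graph_map_pi. Qed.

Lemma graph_map_continuous : continuous graph_map.
Proof.
apply: repr_comp_continuous; first exact: cells_map_continuous.
move=> p p' /eqP/eqmodP/eqP pp'; apply/eqP.
by rewrite -cells_map_attach pp' cells_map_attach.
Qed.

End canonical_map.

Arguments graph_map_continuous {R Z At} z.

(* Main.v *)
Require Import Defs.
From mathcomp Require Import all_boot all_order all_algebra.
From mathcomp Require Import generic_quotient monoid lra.
From mathcomp Require Import all_classical all_reals topology normedtype.

(** A homotopy inverse [psi] of [graph_map] is built strip by strip. Around each
    boundary interval of a strip put a collar, on which a height function grows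
    from 0 to 1 (with value 1 exactly on the interval); distinct collars are
    disjoint. Send the collar of a glued interval to the corresponding half of
    its edge by means of the height, and everything else to the vertex of the
    strip. The glued intervals go to the midpoints of the edges, so this map
    descends to Z. The composite [psi \o graph_map] maps every edge to itself
    fixing its ends, so it is homotopic to the identity; the product of a
    quotient map with the identity of the line is again a quotient map, which
    makes homotopies descend to quotients. The composite [graph_map \o psi]
    lifts to self-maps of the strips, and the straight-line homotopy of these to
    the identity, corrected near the glued intervals by a contraction of the
    seams which does not depend on the side it is read from, descends to Z. The
    statement on fundamental groups holds for every homotopy equivalence. *)

Set Implicit Arguments.
Unset Strict Implicit.
Unset Printing Implicit Defensive.

Import Order.TTheory GRing.Theory Num.Theory.
Import numFieldNormedType.Exports.

Local Open Scope classical_set_scope.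
Local Open Scope ring_scope.

(** * Continuity and quotient maps *)

Lemma inj_surj_bijective (A B : Type) (f : A -> B) :
  injective f -> (forall b, exists a, f a = b) -> bijective f.
Proof.
move=> fI /choice[g fg]; exists g => // a.
by apply: fI; rewrite fg.
Qed.

Section limits.
Context {R : realType} {T : Type} (F : set_system T) {FF : Filter F}.
Implicit Types f g : T -> R.

Lemma cvg_maxr f g (a b : R) : f @ F --> a -> g @ F --> b ->
  (fun x => Num.max (f x) (g x)) @ F --> Num.max a b.
Proof.
by move=> fa gb; exact: cvg_comp (cvg_pair fa gb) (@max_continuous _ R (a, b)).
Qed.

Lemma cvg_minr f g (a b : R) : f @ F --> a -> g @ F --> b ->
  (fun x => Num.min (f x) (g x)) @ F --> Num.min a b.
Proof.
by move=> fa gb; exact: cvg_comp (cvg_pair fa gb) (@min_continuous _ R (a, b)).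
Qed.

End limits.

Section clamp.
Context {R : realType}.
Notation I01 := (`[0, 1]%classic : set R).

(** Retraction of the line onto [0, 1]; precomposing time with it turns homotopies continuous within
    the unit interval into globally continuous maps. *)
Definition clamp (t : R) : R := Num.max 0 (Num.min 1 t).

Lemma clamp_continuous : continuous clamp.
Proof.
move=> t; apply: cvg_maxr; first exact: cvg_cst.
by apply: cvg_minr; [exact: cvg_cst | exact: cvg_id].
Qed.

Lemma clamp_itv t : 0 <= clamp t <= 1.
Proof. rewrite /clamp; case: (leP 0 (Num.min 1 t)); case: (leP 1 t); lra. Qed.

Lemma I01_clamp t : I01 (clamp t).
Proof. by rewrite /= in_itv /= clamp_itv. Qed.

Lemma clamp_id t : 0 <= t <= 1 -> clamp t = t.
Proof. rewrite /clamp; case: (leP 0 (Num.min 1 t)); case: (leP 1 t); lra. Qed.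

Lemma clamp_le0 t : t <= 0 -> clamp t = 0.
Proof. rewrite /clamp; case: (leP 0 (Num.min 1 t)); case: (leP 1 t); lra. Qed.

Lemma clamp_ge1 t : 1 <= t -> clamp t = 1.
Proof. rewrite /clamp; case: (leP 0 (Num.min 1 t)); case: (leP 1 t); lra. Qed.

End clamp.

Section homotopies.
Context {R : realType}.

Lemma homotopic_of_continuous {T U : topologicalType} (f g : T -> U)
    (H : T * R -> U) :
  continuous H -> (forall x, H (x, 0) = f x) -> (forall x, H (x, 1) = g x) ->
  homotopic R f g.
Proof. by move=> cH H0 H1; exists H; split => //; exact: continuous_within. Qed.

Lemma homotopic_continuous {T U : topologicalType} (f g : T -> U) :
  homotopic R f g -> exists H : T * R -> U,
    [/\ continuous H, forall x, H (x, 0) = f x & forall x, H (x, 1) = g x].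
Proof.
move=> [H [cH H0 H1]]; exists (fun z => H (z.1, clamp z.2)); split => [|x|x].
- apply/continuous_subspace_setT.
  apply: (@within_continuous_comp_sub _ _ _ _ _
    (fun z : T * R => (z.1, clamp z.2)) H _ _ cH).
    apply: continuous_within; apply: continuous_pair => z; first exact: cvg_fst.
    apply: (@continuous_comp _ _ _ snd (clamp : R -> R)); first exact: cvg_snd.
    exact: clamp_continuous.
  by move=> z _; split => //; exact: I01_clamp.
- by rewrite /= clamp_le0.
- by rewrite /= clamp_ge1.
Qed.

(** The reason is local compactness of the line: a tube argument over a compact segment of times
    yields an open set defined by a condition on points of [U], so its preimage under [q] is
    automatically saturated. *)
Lemma quotient_map_prod_continuous {T U V : topologicalType} (q : T -> U)
    (F : U * R -> V) :
  quotient_map q -> continuous (fun z : T * R => F (q z.1, z.2)) ->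
  continuous F.
Proof.
move=> [qT qO] cF [y0 k0] W; rewrite nbhsE => -[O [oO OF] OW].
have [x0 _ qx0] : range q y0 by rewrite qT.
have {}OF : O (F (q x0, k0)) by rewrite qx0.
have /= := cF (x0, k0) O (open_nbhs_nbhs (conj oO OF)).
move=> -[[A B] [/= nA nB] ABO].
have /nbhs_ballP[e /= e0 eB] := nB.
(* Halving the radius keeps this closed segment inside the ball given by [eB]. *)
pose C := `[k0 - e / 2, k0 + e / 2]%classic : set R.
have cC : compact C by exact: segment_compact.
pose V1 := [set y | C `<=` [set k | O (F (y, k))]].
(* Tube lemma: openness is tested on the preimage in [T], where compactness of [C] makes the
   condition hold near each of its points. *)
have oV1 : open V1.
  apply/qO; rewrite openE => x Vx; rewrite /interior.
  have /compact_near_coveringP/(_ T (nbhs x)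
    (fun x' k => O (F (q x', k))) _) := cC.
  apply => k Ck.
  have := cF (x, k) O (open_nbhs_nbhs (conj oO (Vx k Ck))).
  by move=> -[[A' B'] [/= nA' nB'] AB']; exists (B', A') => // -[k' x'] [/= *];
    exact: (AB' (x', k')).
have V1y : V1 y0.
  move=> k; rewrite /C /= in_itv /= => kC.
  rewrite -qx0; apply: (ABO (x0, k)); split => /=; first exact: nbhs_singleton.
  by apply: eB; rewrite /ball /= ltr_distlC; lra.
exists (V1, C) => /=; first split.
- exact: open_nbhs_nbhs.
- by apply/nbhs_ballP; exists (e / 2) => /=; [lra | move=> k;
    rewrite /ball /= ltr_distlC /C /= in_itv /=; lra].
- by move=> [y k] [/= Vy Ck]; apply: OW; exact: Vy.
Qed.

Lemma quotient_map_continuous {T U V : topologicalType} (q : T -> U)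
    (f : U -> V) : quotient_map q -> continuous (f \o q) -> continuous f.
Proof.
move=> [_ qO] /continuousP cf; apply/continuousP => O oO.
by apply/qO; rewrite -comp_preimage; exact: cf.
Qed.

End homotopies.

Lemma near_eq_continuous {T U : topologicalType} (f g : T -> U) (x : T) :
  (\forall y \near x, f y = g y) -> {for x, continuous f} ->
  {for x, continuous g}.
Proof.
move=> fg; rewrite /prop_for /continuous_at (nbhs_singleton fg) => cf.
by apply: cvg_trans cf; exact: near_eq_cvg.
Qed.

Lemma within_comp_continuous {T U V : topologicalType} (A : set U) (f : T -> U)
    (g : U -> V) (x : T) :
  {within A, continuous g} -> {for x, continuous f} ->
  (\forall y \near x, A (f y)) -> {for x, continuous (g \o f)}.
Proof.
move=> /subspace_continuousP cg cf nA W nW.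
have := cf _ (cg _ (nbhs_singleton nA) W nW).
change ((\forall y \near x, A (f y) -> W (g (f y))) ->
        \forall y \near x, W (g (f y))).
by move=> h; apply: filterS2 nA h => y Afy; apply.
Qed.

Lemma pair_continuous_at {T U V : topologicalType} (f : T -> U) (g : T -> V)
    (x : T) : {for x, continuous f} -> {for x, continuous g} ->
  {for x, continuous (fun y => (f y, g y))}.
Proof. by move=> cf cg; apply: cvg_pair; [exact: cf | exact: cg]. Qed.

(** An open [O] around [g w] is cut out on the image by some open [V], and injectivity of [f] forces
    [g] to send that piece back into [O]. *)
Lemma embedding_on_inv_continuous {T U : topologicalType} (D : set T)
    (f : T -> U) (g : U -> T) : embedding_on D f ->
  (forall w, (f @` D) w -> D (g w) /\ f (g w) = w) ->
  {within f @` D, continuous g}.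
Proof.
move=> [fI _ fO] gP; apply/subspace_continuousP => w Dw W.
rewrite nbhsE => -[O [oO Ow] OW]; have [V oV VE] := fO O oO.
have [Dgw fgw] := gP _ Dw.
have Vw : V w.
  suff [] : (f @` D `&` V) w by [].
  by rewrite -VE; exists (g w).
have : nbhs w V by exact: open_nbhs_nbhs.
apply: filterS => w' Vw' Dw'; change (W (g w')); apply: OW.
have [Dgw' fgw'] := gP _ Dw'.
have [x [Dx Ox] fx] : (f @` (D `&` O)) w' by rewrite VE.
by rewrite (fI (g w') x) ?inE // fgw' fx.
Qed.

(** * Homotopy equivalences induce isomorphisms of fundamental groups *)

Section conjugate_loops.
Context {R : realType} {T : topologicalType}.
Notation I01 := (`[0, 1]%classic : set R).

Lemma eq_loop_homotopic (x : T) (p q : loop R x) :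
  (forall t, I01 t -> p t = q t) -> loop_homotopic p q.
Proof.
move=> pq; apply: (@reparam_homotopic _ _ x p id id) => //.
- exact: loop_continuous.
- by apply: continuous_within => t; exact: cvg_id.
- by apply: continuous_within => t; exact: cvg_id.
- by move=> t /pq.
Qed.

Section conj_loop.
Context (x y : T) (c : R -> T) (c_continuous : continuous c).
Context (c0 : c 0 = x) (c1 : c 1 = y).

(** The change of base point [c r c^-1], traversed in thirds. As [c] is a path rather than a loop,
    [loop_cat] does not apply. *)
Definition conj_loop_fun (r : R -> T) (t : R) : T :=
  if t <= 3^-1 then c (3 * t)
  else if t <= 2 / 3 then r (3 * t - 1) else c (3 - 3 * t).

(* Stated for a family of loops [L] so that it also covers homotopies. *)
Lemma conj_loop_fun_continuous (L : R * R -> T) :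
  {within I01 `*` I01, continuous L} ->
  (forall s, I01 s -> L (0, s) = y /\ L (1, s) = y) ->
  {within I01 `*` I01, continuous
    (fun z : R * R => conj_loop_fun (fun t => L (t, z.2)) z.1)}.
Proof.
move=> cL Ly; have cfst : continuous (@fst R R) by move=> z; exact: cvg_fst.
have caff : {within I01 `*` I01 `&` [set z | 3^-1 <= z.1] `&`
    [set z | 2 / 3 <= z.1], continuous (fun z => c (3 - 3 * z.1))}.
  apply: continuous_within => z; apply: continuous_comp; last exact: c_continuous.
  apply: cvgB; first exact: cvg_cst.
  by apply: cvgM; [exact: cvg_cst | exact: cvg_fst].
apply: (within_continuous_cases cfst closed_I01X).
- apply: continuous_within => z; apply: continuous_comp; last exact: c_continuous.
  by apply: cvgM; [exact: cvg_cst | exact: cvg_fst].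
- apply: (within_continuous_cases cfst).
  + apply: closedI; first exact: closed_I01X.
    by move: ((continuous_closedP _).1 cfst) => /(_ _ (@closed_ge R 3^-1)).
  + rewrite (_ : (fun _ => _) = L \o (fun z => (3 * z.1 + (-1), 1 * z.2 + 0))).
      apply: (within_continuous_comp_sub _ _ cL).
        exact/continuous_within/continuous_stage.
      by move=> [t s] [[[/=]]]; rewrite !in_itv /= => *; split; lra.
    by apply/funext => -[t s] /=; rewrite mul1r addr0.
  + exact: caff.
  + move=> [t s] [[/= It Is] _] ->.
    rewrite (_ : 3 * (2 / 3) - 1 = 1); last lra.
    by rewrite (_ : 3 - 3 * (2 / 3) = 1) ?c1 ?(Ly _ Is).2 //; lra.
- move=> [t s] [/= It Is] ->; rewrite ifT; last lra.
  by rewrite divff ?pnatr_eq0// subrr (Ly _ Is).1 c1.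
Qed.


Lemma conj_loop_continuous (r : loop R y) :
  {within I01, continuous (conj_loop_fun r)}.
Proof.
have I0 : I01 (0 : R) by rewrite in_I01; lra.
have cL : {within I01 `*` I01, continuous (fun z : R * R => r z.1)}.
  apply: (within_continuous_comp_sub _ _ (@loop_continuous _ _ _ r)).
    by apply: continuous_within => z; exact: cvg_fst.
  by move=> z [].
have Ly s : I01 s -> r 0 = y /\ r 1 = y by rewrite loop_start loop_end.
apply: (@within_continuous_comp_sub _ _ _ I01 (I01 `*` I01)
  (fun t : R => (t, 0 : R)) (fun z => conj_loop_fun r z.1)) => //.
  apply/continuous_within/continuous_pair => t; last exact: cvg_cst.
  exact: cvg_id.
exact: (conj_loop_fun_continuous cL Ly).
Qed.

Lemma conj_loop_start (r : R -> T) : conj_loop_fun r 0 = x.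
Proof. by rewrite /conj_loop_fun ifT ?mulr0 ?c0 //; lra. Qed.

Lemma conj_loop_end (r : R -> T) : conj_loop_fun r 1 = x.
Proof.
rewrite /conj_loop_fun ifF; last by apply/negbTE; lra.
by rewrite ifF ?mulr1 ?subrr ?c0 //; apply/negbTE; lra.
Qed.

Definition conj_loop (r : loop R y) : loop R x :=
  Loop (@conj_loop_continuous r) (conj_loop_start r) (conj_loop_end r).

Lemma conj_loop_homotopic (r r' : loop R y) :
  loop_homotopic r r' -> loop_homotopic (conj_loop r) (conj_loop r').
Proof.
move=> [L [cL L0 L1 Ly]].
exists (fun z => conj_loop_fun (fun t => L (t, z.2)) z.1); split.
- exact: conj_loop_fun_continuous.
- move=> t; rewrite in_I01 /= /conj_loop_fun => It.
  case: (leP t 3^-1) => // ?; case: (leP t (2 / 3)) => // ?.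
  by rewrite L0 // in_I01; lra.
- move=> t; rewrite in_I01 /= /conj_loop_fun => It.
  case: (leP t 3^-1) => // ?; case: (leP t (2 / 3)) => // ?.
  by rewrite L1 // in_I01; lra.
- by move=> s _; rewrite conj_loop_start conj_loop_end.
Qed.

(** The bottom of the square is moved along straight segments, inside the square, to the path going
    up the left side, along the top and down the right side. *)
Lemma square_conj_loop (K : R * R -> T) (p : loop R x) (r : loop R y) :
  {within I01 `*` I01, continuous K} ->
  (forall t, I01 t -> K (t, 0) = p t) -> (forall t, I01 t -> K (t, 1) = r t) ->
  (forall s, I01 s -> K (0, s) = c s /\ K (1, s) = c s) ->
  loop_homotopic p (conj_loop r).
Proof.
move=> cK K0 K1 Kc.
(* The point [(v1 t, v2 t)] runs over these three sides, one on each third of the unit interval. *)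
pose v1 (t : R) := clamp (3 * t - 1).
pose v2 (t : R) := clamp (Num.min (3 * t) (3 - 3 * t)).
have c3 : continuous (fun z : R * R => 3 * z.1 : R).
  by move=> z; apply: cvgM; [exact: cvg_cst | exact: cvg_fst].
have cv1 : continuous (fun z : R * R => v1 z.1).
  move=> z; apply: (@continuous_comp _ _ _
    (fun z : R * R => 3 * z.1 - 1 : R) (clamp : R -> R));
    last exact: clamp_continuous.
  by apply: cvgB; [exact: c3 | exact: cvg_cst].
have cv2 : continuous (fun z : R * R => v2 z.1).
  move=> z; apply: (@continuous_comp _ _ _
    (fun z : R * R => Num.min (3 * z.1) (3 - 3 * z.1) : R) (clamp : R -> R));
    last exact: clamp_continuous.
  apply: cvg_minr; first exact: c3.
  by apply: cvgB; [exact: cvg_cst | exact: c3].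
exists (K \o (fun z => ((1 - z.2) * z.1 + z.2 * v1 z.1, z.2 * v2 z.1))); split.
- apply: (within_continuous_comp_sub _ _ cK).
    apply: continuous_within; apply: continuous_pair => z.
      apply: cvgD; apply: cvgM.
      + by apply: cvgB; [exact: cvg_cst | exact: cvg_snd].
      + exact: cvg_fst.
      + exact: cvg_snd.
      + exact: cv1.
    by apply: cvgM; [exact: cvg_snd | exact: cv2].
  move=> [t s] [/=]; rewrite !in_itv /= => It Is.
  have := clamp_itv (3 * t - 1); rewrite -/(v1 t).
  have := clamp_itv (Num.min (3 * t) (3 - 3 * t)); rewrite -/(v2 t).
  by move=> h2 h1; split; apply/andP; split; nra.
- by move=> t It /=; rewrite subr0 !mul0r mul1r addr0 K0.
- move=> t; rewrite in_I01 => It; rewrite /= subrr mul0r add0r !mul1r.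
  have I01v1 : I01 (v1 t) by exact: I01_clamp.
  have I01v2 : I01 (v2 t) by exact: I01_clamp.
  rewrite /conj_loop_fun; case: (leP t 3^-1) => h1.
    have v10 : v1 t = 0 by apply: clamp_le0; lra.
    rewrite v10 (Kc _ I01v2).1; congr c; rewrite /v2 min_l; last lra.
    by rewrite clamp_id //; lra.
  case: (leP t (2 / 3)) => h2.
    have v21 : v2 t = 1 by apply: clamp_ge1; rewrite le_min; lra.
    by rewrite v21 K1 //; congr (r _); rewrite /v1 clamp_id //; lra.
  have v11 : v1 t = 1 by apply: clamp_ge1; lra.
  rewrite v11 (Kc _ I01v2).2; congr c; rewrite /v2 min_r; last lra.
  by rewrite clamp_id //; lra.
- move=> s _ /=; have v10 : v1 0 = 0 by apply: clamp_le0; lra.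
  have v11 : v1 1 = 1 by apply: clamp_ge1; lra.
  have v20 : v2 0 = 0 by rewrite /v2 min_l ?clamp_le0 //; lra.
  have v21 : v2 1 = 0 by rewrite /v2 min_r ?clamp_le0 //; lra.
  rewrite v10 v11 v20 v21 !mulr0 !mulr1 addr0 subrK.
  by rewrite !K0 ?loop_start ?loop_end // in_I01; lra.
Qed.

End conj_loop.

(** Conjugating once more by the reversed path [d] gives back the original loop up to homotopy. *)
Lemma conj_loop_inj (x y : T) (c : R -> T) (cc : continuous c)
    (c0 : c 0 = x) (c1 : c 1 = y) (r r' : loop R y) :
  loop_homotopic (conj_loop cc c0 c1 r) (conj_loop cc c0 c1 r') ->
  loop_homotopic r r'.
Proof.
pose d s := c (1 - s).
have cd : continuous d.
  move=> s; apply: continuous_comp; last exact: cc.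
  by apply: cvgB; [exact: cvg_cst | exact: cvg_id].
have d0 : d 0 = y by rewrite /d subr0.
have d1 : d 1 = x by rewrite /d subrr.
have rK (u : loop R y) :
    loop_homotopic u (conj_loop cd d0 d1 (conj_loop cc c0 c1 u)).
  (* At time 0 this runs over the middle third, where the conjugate is [u] itself, and at time 1
     over the whole conjugate; meanwhile both ends move along [d]. *)
  pose w (z : R * R) := (1 - z.2) * ((1 + z.1) / 3) + z.2 * z.1.
  apply: (@square_conj_loop _ _ _ _ _ _ (conj_loop cc c0 c1 u \o w)).
  - apply: (within_continuous_comp_sub _ _
      (@loop_continuous _ _ _ (conj_loop cc c0 c1 u))).
      apply: continuous_within => z; apply: cvgD; apply: cvgM.
      + by apply: cvgB; [exact: cvg_cst | exact: cvg_snd].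
      + apply: cvgM; last exact: cvg_cst.
        by apply: cvgD; [exact: cvg_cst | exact: cvg_fst].
      + exact: cvg_snd.
      + exact: cvg_fst.
    by move=> [t s] [/=]; rewrite !in_itv /w /= => ? ?; apply/andP; split; nra.
  - move=> t; rewrite in_I01 /= /w /conj_loop_fun /= => It.
    case: (leP _ 3^-1) => h1.
      have -> : t = 0 by lra.
      by rewrite loop_start -c1; congr c; lra.
    by rewrite ifT; [congr (u _); lra | lra].
  - by move=> t It; rewrite /= /w /=; congr conj_loop_fun; lra.
  - move=> s; rewrite in_I01 => Is; split; rewrite /= /w /conj_loop_fun /d /=.
      by rewrite ifT; [congr c; lra | lra].
    rewrite ifF; last by apply/negbTE; nra.
    case: (leP _ (2 / 3)) => h1; last by congr c; lra.
    have -> : s = 0 by nra.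
    rewrite [X in c X]subr0 c1 -[RHS](loop_end u).
    by congr (u _); lra.
move=> rr'; apply: loop_homotopic_trans (rK r) _.
apply/loop_homotopic_sym/(loop_homotopic_trans (rK r'))/conj_loop_homotopic.
exact: loop_homotopic_sym.
Qed.

End conjugate_loops.

Section induced_isomorphism.
Context {R : realType}.
Local Open Scope quotient_scope.

Lemma pi1_class {T : topologicalType} (x : T) (a : pi1 R x) :
  exists p, a = loop_class p.
Proof. by exists (repr a); rewrite loop_class_repr. Qed.

Lemma pi1_map_morph {T U : topologicalType} (f : T -> U) (cf : continuous f)
    (x : T) : {morph @pi1_map R _ _ f cf x : a b / (a * b)%g}.
Proof.
move=> a b; have [p ->] := pi1_class a; have [q ->] := pi1_class b.
rewrite [LHS](congr1 (pi1_map cf (x := x)) (pi1_mulE p q)) !pi1_mapE.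
rewrite [RHS]pi1_mulE; apply/loop_classP/eq_loop_homotopic => t _ /=.
by rewrite /loop_cat_fun /=; case: ifP.
Qed.

(** The homotopy need not fix the base point. Its track [c] from [x] to [k x] makes every loop [p]
    homotopic to the conjugate of [k p] by [c], so the induced map followed by conjugation is the
    identity. *)
Lemma pi1_map_homotopic_id {T : topologicalType} (k : T -> T)
    (ck : continuous k) (x : T) :
  homotopic R k id ->
  injective (@pi1_map R _ _ k ck x) /\
  forall b, exists a, @pi1_map R _ _ k ck x a = b.
Proof.
move=> /homotopic_continuous[H [cH H0 H1]].
pose c s := H (x, 1 - s).
have cc : continuous c.
  move=> s; apply: (@continuous_comp _ _ _ (fun s : R => (x, 1 - s : R)) H);
    last exact: cH.
  apply: continuous_pair => {}s; first exact: cvg_cst.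
  by apply: cvgB; [exact: cvg_cst | exact: cvg_id].
have c0 : c 0 = x by rewrite /c subr0 H1.
have c1 : c 1 = k x by rewrite /c subrr H0.
have conjk (p : loop R x) :
    loop_homotopic p (conj_loop cc c0 c1 (loop_map ck p)).
  apply: (@square_conj_loop _ _ _ _ _ _ _ _ (fun z => H (p z.1, 1 - z.2))).
  - apply: (@within_continuous_comp_sub _ _ _ _ setT
      (fun z : R * R => (p z.1, 1 - z.2)) H) => //; last first.
      exact: continuous_within.
    apply: within_continuous_pair.
      apply: (within_continuous_comp_sub _ _ (@loop_continuous _ _ _ p)).
        by apply: continuous_within => z; exact: cvg_fst.
      by move=> z [].
    apply: continuous_within => z.
    by apply: cvgB; [exact: cvg_cst | exact: cvg_snd].
  - by move=> t _ /=; rewrite subr0 H1.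
  - by move=> t _ /=; rewrite subrr H0.
  - by move=> s _; rewrite /= loop_start loop_end.
split.
- move=> a b; have [p ->] := pi1_class a; have [q ->] := pi1_class b.
  rewrite !pi1_mapE => /loop_classP pq; apply/loop_classP.
  apply: loop_homotopic_trans (conjk p) _.
  apply/loop_homotopic_sym/(loop_homotopic_trans (conjk q))/conj_loop_homotopic.
  exact: loop_homotopic_sym.
- move=> b; have [r ->] := pi1_class b.
  (* Applying [conjk] to the conjugate of [r] and cancelling the outer conjugation shows that [k]
     sends it to the class of [r]. *)
  exists (loop_class (conj_loop cc c0 c1 r)); rewrite pi1_mapE.
  apply/loop_classP/loop_homotopic_sym/(@conj_loop_inj _ _ _ _ _ cc c0 c1).
  exact: conjk.
Qed.

Lemma pi1_map_comp {T U V : topologicalType} (f : T -> U) (g : U -> V)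
    (cf : continuous f) (cg : continuous g) (cgf : continuous (g \o f))
    (x : T) (a : pi1 R x) :
  pi1_map cg (pi1_map cf a) = pi1_map cgf a.
Proof.
have [p ->] := pi1_class a; rewrite !pi1_mapE.
exact/loop_classP/eq_loop_homotopic.
Qed.

(** Injectivity of the map induced by [f] comes from [g \o f], and that of the map induced by [g]
    from [f \o g]. For surjectivity, the image of [b] under [g] is lifted through [g \o f], and [g]
    is cancelled. *)
Lemma homotopy_equivalence_pi1 {T U : topologicalType} (f : T -> U)
    (cf : continuous f) (x : T) :
  homotopy_equivalence R f -> group_isomorphism (@pi1_map R _ _ f cf x).
Proof.
move=> [_ [g [cg gf fg]]]; split; first exact: pi1_map_morph.
have cgf : continuous (g \o f).
  by move=> y; apply: continuous_comp; [exact: cf | exact: cg].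
have cfg : continuous (f \o g).
  by move=> y; apply: continuous_comp; [exact: cg | exact: cf].
have [gfI gfS] := pi1_map_homotopic_id cgf x gf.
have [fgI _] := pi1_map_homotopic_id cfg (f x) fg.
have gI : injective (@pi1_map R _ _ g cg (f x)).
  by move=> a b ab; apply: fgI; rewrite -!(pi1_map_comp cg cf) ab.
apply: inj_surj_bijective => [a b ab|b].
  by apply: gfI; rewrite -!(pi1_map_comp cf cg) ab.
have [a ab] := gfS (pi1_map cg b); exists a; apply: gI.
by rewrite (pi1_map_comp cf cg cgf).
Qed.

End induced_isomorphism.

(** * Collars of boundary intervals *)

Section collars.
Context {R : realType}.
Implicit Types (S J : set (R * R)) (e x y s t : R) (p u v : R * R).

Definition sign_unit e := e = -1 \/ e = 1.

(** Its supremum [depth] is the distance from [x] to the complement of the boundary on the side [e],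
    cut off at 1/2. The cut-off keeps the supremum finite and the collars of the two sides apart. *)
Definition depth_set S e x : set R :=
  [set r | 0 <= r <= 2^-1 /\ forall x', `|x - x'| < r -> S (x', e)].

Definition depth S e x : R := sup (depth_set S e x).

Lemma depth_set0 S e x : depth_set S e x 0.
Proof.
by split => [|x']; [lra | rewrite ltNge normr_ge0].
Qed.

Lemma depth_set_le S e x r : depth_set S e x r -> r <= depth S e x.
Proof. by apply: ub_le_sup; exists 2^-1 => r' [/andP[]]. Qed.

Lemma depth_itv S e x : 0 <= depth S e x <= 2^-1.
Proof.
apply/andP; split; first exact/depth_set_le/depth_set0.
by apply: ge_sup => [|r' [/andP[]]//]; exists 0; exact: depth_set0.
Qed.

(** The interval of radius [r] around [x] contains the one of radius [r - |x - x'|] around [x']. *)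
Lemma depth_lipschitz S e x x' : depth S e x <= depth S e x' + `|x - x'|.
Proof.
apply: ge_sup; first by exists 0; exact: depth_set0.
move=> r [r01 rS]; rewrite -lerBlDr.
have [rx|rx] := leP r `|x - x'|.
  by apply: le_trans (proj1 (andP (depth_itv S e x'))); lra.
apply: depth_set_le; split; first by have := normr_ge0 (x - x'); lra.
move=> x'' hx; apply: rS; have := ler_distD x' x x''; lra.
Qed.

Lemma depth_continuous S e : continuous (depth S e).
Proof.
move=> x; apply/cvgrPdist_le => /= d d0; near=> x'.
have : `|x - x'| <= d by near: x'; exact: cvgr_dist_le.
have := depth_lipschitz S e x x'; have := depth_lipschitz S e x' x.
rewrite (distrC x' x) => h1 h2 h3; rewrite ler_distlC; lra.
Unshelve. all: by end_near. Qed.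

Lemma depth_out S e x : ~ S (x, e) -> depth S e x = 0.
Proof.
move=> Sx; apply/eqP; rewrite eq_le (proj1 (andP (depth_itv S e x))) andbT.
apply: ge_sup; first by exists 0; exact: depth_set0.
move=> r [_ rS]; rewrite leNgt; apply/negP => r0; apply: Sx; apply: rS.
by rewrite subrr normr0.
Qed.

(** Components of the boundary are open along the side: the open interval of the model strip that
    contains [x] is connected, so it lies in the component. *)
Lemma strip_boundary_near S e x : model_strip S -> sign_unit e -> S (x, e) ->
  \forall x' \near x, connected_component (strip_boundary S) (x, e) (x', e).
Proof.
move=> [_ _ hF] he Sx; have [F [_ _ FJ SF]] := hF _ he.
have [J FJ' Jx] : (\bigcup_(J in F) J) x by rewrite -SF.
have [oJ iJ] := FJ _ FJ'.
have : nbhs x J by exact: open_nbhs_nbhs.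
apply: filterS => x' Jx'; exists ((fun t => (t, e)) @` J).
  split; first by exists x.
    move=> _ [t Jt <-]; split => //.
    have : (\bigcup_(J in F) J) t by exists J.
    by rewrite -SF.
  apply: connected_continuous_connected; first exact/connected_intervalP.
  apply: continuous_within; apply: continuous_pair => t; first exact: cvg_id.
  exact: cvg_cst.
by exists x'.
Qed.

Lemma depth_gt0 S e x : model_strip S -> sign_unit e -> S (x, e) ->
  0 < depth S e x.
Proof.
move=> hS he Sx; have := strip_boundary_near hS he Sx.
move=> /nbhs_ballP[d /= d0 dS].
apply: (@lt_le_trans _ _ (Num.min d 2^-1)); first by rewrite lt_min d0; lra.
apply: depth_set_le; split; first by case: (leP d 2^-1) => *; lra.
move=> x'; rewrite lt_min => /andP[xd _].
by have /connected_component_sub[] := dS x' xd.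
Qed.

(** With [d] the depth and [k] the distance to the side, this is [1 - k / d] for [k <= d] and
    [d > 0], and 0 further away. The maximum in the denominator makes it vanish only at [d = k = 0],
    away from the strip. *)
Definition height S e p : R :=
  Num.max 0 (depth S e p.1 - (1 - e * p.2)) /
  Num.max (depth S e p.1) (1 - e * p.2).

Lemma height_itv S e p : e * p.2 <= 1 -> 0 <= height S e p <= 1.
Proof.
rewrite /height; have := depth_itv S e p.1.
set d := depth _ _ _; set k := e * _ => d01 ep.
have m0 : 0 <= Num.max d (1 - k) by rewrite le_max (andP d01).1.
apply/andP; split; first by rewrite divr_ge0 // le_max lexx.
have [m_gt0|] := ltP 0 (Num.max d (1 - k)); last first.
  move=> m_le0; have -> : Num.max d (1 - k) = 0 by apply: le_anti; rewrite m0 m_le0.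
  by rewrite invr0 mulr0.
rewrite ler_pdivrMr // mul1r ge_max m0 le_max; apply/orP; left; lra.
Qed.

Lemma height_eq0 S e p : depth S e p.1 <= 1 - e * p.2 -> height S e p = 0.
Proof. by move=> h; rewrite /height max_l ?mul0r // subr_le0. Qed.

Lemma height_low S e p : e * p.2 <= 2^-1 -> height S e p = 0.
Proof. by move=> h; apply: height_eq0; have := depth_itv S e p.1; lra. Qed.

Lemma height_eq1 S e p : model_strip S -> sign_unit e -> S (p.1, e) ->
  e * p.2 = 1 -> height S e p = 1.
Proof.
move=> hS he Sp ep; have := depth_gt0 hS he Sp.
rewrite /height ep subrr subr0 => d0.
by rewrite max_r ?ltW // max_l ?ltW // divff // gt_eqF.
Qed.

Lemma height_lt1 S e p : e * p.2 < 1 -> height S e p < 1.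
Proof.
rewrite /height; have := depth_itv S e p.1.
set d := depth _ _ _; set k := e * _ => d01 ep.
have m0 : 0 < Num.max d (1 - k) by rewrite lt_max orbC; apply/orP; left; lra.
by rewrite ltr_pdivrMr // mul1r gt_max m0 /= lt_max; apply/orP; left; lra.
Qed.

Lemma height_continuous S e p : 0 < depth S e p.1 ->
  {for p, continuous (height S e)}.
Proof.
move=> d0; have cd : {for p, continuous (fun p => depth S e p.1)}.
  apply: (@continuous_comp _ _ _ fst (depth S e)); first exact: cvg_fst.
  exact: depth_continuous.
have ce : {for p, continuous (fun p => 1 - e * p.2 : R)}.
  apply: cvgB; first exact: cvg_cst.
  by apply: cvgM; [exact: cvg_cst | exact: cvg_snd].
apply: cvgM.
  by apply: cvg_maxr; [exact: cvg_cst | exact: cvgB cd ce].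
by apply: cvgV; [rewrite gt_eqF // lt_max d0 | exact: cvg_maxr].
Qed.

Lemma boundary_intervalE S J u : boundary_interval S J -> J u ->
  J = connected_component (strip_boundary S) u.
Proof. by move=> [v _ ->] /same_connected_component. Qed.

Lemma boundary_interval_eq S J J' u : boundary_interval S J ->
  boundary_interval S J' -> J u -> J' u -> J = J'.
Proof.
move=> hJ hJ' Ju J'u.
by rewrite (boundary_intervalE hJ Ju) (boundary_intervalE hJ' J'u).
Qed.

(** The second coordinates form a connected subset of the line; if both -1 and 1 occurred, so would
    0. *)
Lemma boundary_interval_side S J u v : boundary_interval S J -> J u -> J v ->
  u.2 = v.2.
Proof.
move=> hJ Ju Jv; have JS := boundary_interval_sub hJ.
have cJ : connected J by have [w _ ->] := hJ; exact: component_connected.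
have : is_interval (snd @` J).
  apply/connected_intervalP/connected_continuous_connected => //.
  by apply: continuous_within => z; exact: cvg_snd.
have Iu : (snd @` J) u.2 by exists u.
have Iv : (snd @` J) v.2 by exists v.
have no0 : ~ (snd @` J) 0 by move=> [w /JS[_ hw] w0]; case: hw; rewrite w0; lra.
have [_ hu] := JS _ Ju; have [_ hv] := JS _ Jv.
move=> iJ; case: hu hv => -> [] -> // in Iu Iv *; exfalso; apply: no0.
  by apply: (iJ _ _ Iu Iv); lra.
by apply: (iJ _ _ Iv Iu); lra.
Qed.

Lemma boundary_interval_convex S J u v s : boundary_interval S J ->
  J u -> J v -> 0 <= s <= 1 -> J ((1 - s) * u.1 + s * v.1, u.2).
Proof.
move=> hJ Ju Jv s01.
have cJ : connected J by have [w _ ->] := hJ; exact: component_connected.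
have iJ : is_interval (fst @` J).
  apply/connected_intervalP/connected_continuous_connected => //.
  by apply: continuous_within => z; exact: cvg_fst.
have Iu : (fst @` J) u.1 by exists u.
have Iv : (fst @` J) v.1 by exists v.
have [w Jw <-] : (fst @` J) ((1 - s) * u.1 + s * v.1).
  have [uv|vu] := leP u.1 v.1.
    by apply: (iJ _ _ Iu Iv); apply/andP; split; nra.
  by apply: (iJ _ _ Iv Iu); apply/andP; split; nra.
by rewrite (boundary_interval_side hJ Ju Jw) -surjective_pairing.
Qed.

End collars.

(** * Contraction of the seams *)

Section seam_sides.
Context {R : realType} {Z : topologicalType} (At : striped_atlas R Z).
Context (z : seam_points At).
Notation I01 := (`[0, 1]%classic : set R).
Notation q := (@atlas_map R Z At).
Notation strips := (strips (@strip R Z At)).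
Notation coord := (@coords R _ (@strip R Z At)).
(* [(b, true)] stands for X_b and [(b, false)] for Y_b. *)
Notation side := (seam_index At * bool)%type.
Implicit Types (b : seam_index At) (i : side) (u : R * R) (p : strips).
Implicit Types (w : Z) (s : R).

Definition side_strip i : strip_index At := if i.2 then Xidx i.1 else Yidx i.1.

Definition side_interval i : set (R * R) :=
  if i.2 then Xint i.1 else Yint i.1.

Definition side_family i : set strips :=
  in_strip (side_strip i) (side_interval i).

Definition side_point i : R * R :=
  if i.2 then xpoint z i.1 else ypoint z i.1.

Lemma side_interval_boundary i :
  boundary_interval (strip (side_strip i)) (side_interval i).
Proof. by case: i => b [] /=; [exact: Xint_boundary | exact: Yint_boundary]. Qed.

Lemma side_pointP i : [/\ side_interval i (side_point i),
  strip (side_strip i) (side_point i),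
  q (strip_point (side_strip i) (side_point i)) = z i.1 &
  sign_unit (side_point i).2].
Proof. by case: i => b []; [exact: xpointP | exact: ypointP]. Qed.

Lemma side_interval_sub i u : side_interval i u ->
  strip (side_strip i) u /\ sign_unit u.2.
Proof. exact: (boundary_interval_sub (side_interval_boundary i)). Qed.

Lemma side_family_seam i : q @` side_family i = seam i.1.
Proof. by case: i => b [] //; rewrite /seam atlas_map_XY. Qed.

Lemma side_family_map i p : side_family i p -> seam i.1 (q p).
Proof. by move=> ip; rewrite -side_family_seam; exists p. Qed.

Lemma seam_disjoint b b' w : seam b w -> seam b' w -> b = b'.
Proof.
move=> bw b'w; apply: contrapT => bb'.
by have /seteqP[/(_ w) + _] := atlas_map_X_disjoint bb'; apply.
Qed.

(** A common point makes the two components equal. Their common image determines the seam, as seams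
    are disjoint, and [families_disjoint] rules out that one side is X and the other Y. *)
Lemma side_interval_inj i i' u : side_strip i = side_strip i' ->
  side_interval i u -> side_interval i' u -> i = i'.
Proof.
move=> ii' iu i'u; have hi' := side_interval_boundary i'; rewrite -ii' in hi'.
have II' := boundary_interval_eq (side_interval_boundary i) hi' iu i'u.
have ff' : side_family i = side_family i' by rewrite /side_family ii' II'.
have bb' : i.1 = i'.1.
  have [Su _] := side_interval_sub iu.
  have pi : side_family i (strip_point (side_strip i) u).
    by split=> //=; rewrite coords_strip_point.
  have pi' : side_family i' (strip_point (side_strip i) u) by rewrite -ff'.
  exact: seam_disjoint (side_family_map pi) (side_family_map pi').
case: i i' bb' ff' {ii' iu i'u hi' II'} => b c [b' c'] /= <-.
case: c c' => [] [] // ff'; exfalso.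
  exact: (@families_disjoint R Z At b b).
by apply: (@families_disjoint R Z At b b); rewrite -[LHS]ff'.
Qed.

Lemma side_family_embedding i : embedding_on (side_family i) q.
Proof.
by case: i => b []; [exact: atlas_map_X_embedding | exact: atlas_map_Y_embedding].
Qed.

Lemma glued_side p : glued p <-> exists i, side_family i p.
Proof.
split=> [[b _ [bp|bp]]|[[b []] bp]].
- by exists (b, true).
- by exists (b, false).
- by exists b => //; left.
- by exists b => //; right.
Qed.

(** This lists all identifications made by the atlas: a map on the strips descends to the surface
    once it is compatible along each seam. *)
Lemma atlas_map_eq p p' : q p = q p' -> p = p' \/
  exists i i', [/\ i.1 = i'.1, side_family i p & side_family i' p'].
Proof.
have disj i p1 p2 : side_family i p1 -> ~ glued p2 -> q p1 <> q p2.
  move=> ip1 np2 qp.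
  have /seteqP[/(_ (q p1)) + _] := @atlas_map_X_glued R Z At i.1; apply.
  by split; [exact: side_family_map | rewrite qp; exists p2].
move=> qp; have [/glued_side[i ip]|np] := pselect (glued p);
  have [/glued_side[i' ip']|np'] := pselect (glued p').
- right; exists i, i'; split => //.
  apply: seam_disjoint (side_family_map ip) _; rewrite qp.
  exact: side_family_map.
- by have := disj _ _ _ ip np' qp.
- by have := disj _ _ _ ip' np (esym qp).
- by left; apply: (@atlas_map_inj R Z At); rewrite ?inE.
Qed.

(** Inverse of the atlas map on one side of the seam; off the seam it takes the origin of the strip
    as a default value. *)
Definition side_section i w : strips :=
  if pselect (seam i.1 w) is left h
  then projT1 (cid2 (eq_ind_r (fun A : set Z => A w) h (side_family_seam i)))
  else strip_point (side_strip i) (0, 0).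

Lemma side_sectionP i w : seam i.1 w ->
  side_family i (side_section i w) /\ q (side_section i w) = w.
Proof. by rewrite /side_section; case: pselect => // h _; case: cid2. Qed.

Lemma side_sectionK i p : side_family i p -> side_section i (q p) = p.
Proof.
move=> ip; have [jp qp] := side_sectionP (side_family_map ip).
by have [fI _ _] := side_family_embedding i; apply: fI; rewrite ?inE.
Qed.

Lemma side_section_continuous i : {within seam i.1, continuous (side_section i)}.
Proof.
rewrite -side_family_seam; apply: embedding_on_inv_continuous.
  exact: side_family_embedding.
by move=> w; rewrite side_family_seam; exact: side_sectionP.
Qed.

Lemma coords_continuous : continuous coord.
Proof.
apply/continuousP => O oO; apply/sigT_openP => a.
have /continuousP := @initial_continuous (set_type (strip a)) (R * R)%type set_val.
exact.
Qed.

Lemma strip_point_family i u : side_interval i u ->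
  side_family i (strip_point (side_strip i) u).
Proof.
move=> iu; have [Su _] := side_interval_sub iu.
by split=> //=; rewrite coords_strip_point.
Qed.

(* The contraction of the seam to [z b] that is linear in the coordinate of
   X_b. *)
Definition seam_contraction b w s : Z :=
  q (strip_point (Xidx b)
    ((1 - s) * (coords (side_section (b, true) w)).1 + s * (xpoint z b).1,
     (xpoint z b).2)).

Lemma seam_contraction_line b w s : seam b w -> 0 <= s <= 1 ->
  Xint b ((1 - s) * (coords (side_section (b, true) w)).1 + s * (xpoint z b).1,
          (xpoint z b).2).
Proof.
move=> bw s01; have [[_ Xw] _] := @side_sectionP (b, true) w bw.
have [Xz _ _ _] := @xpointP R Z At z b.
have hX := side_interval_boundary (b, true).
rewrite -(boundary_interval_side hX Xw Xz).
exact: (boundary_interval_convex hX Xw Xz).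
Qed.

Lemma seam_contraction_seam b w s : seam b w -> 0 <= s <= 1 ->
  seam b (seam_contraction b w s).
Proof.
move=> bw s01; apply: (@side_family_map (b, true)).
exact/strip_point_family/seam_contraction_line.
Qed.

Lemma seam_contraction0 b w : seam b w -> seam_contraction b w 0 = w.
Proof.
move=> bw; have [[eX Xw] qw] := @side_sectionP (b, true) w bw.
have [Xz _ _ _] := @xpointP R Z At z b.
rewrite /seam_contraction subr0 mul1r mul0r addr0.
rewrite -(boundary_interval_side (side_interval_boundary (b, true)) Xw Xz).
rewrite -surjective_pairing.
by move: (strip_point_coords (side_section (b, true) w)); rewrite eX => ->.
Qed.

Lemma seam_contraction1 b w : seam_contraction b w 1 = z b.
Proof.
rewrite /seam_contraction subrr mul1r mul0r add0r -surjective_pairing.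
by have [] := @xpointP R Z At z b.
Qed.

Lemma seam_contraction_continuous b : {within seam b `*` I01,
  continuous (fun ws : Z * R => seam_contraction b ws.1 ws.2)}.
Proof.
apply: (@within_continuous_comp_sub _ _ _ _ (strip (Xidx b))
  (fun ws : Z * R =>
    ((1 - ws.2) * (coords (side_section (b, true) ws.1)).1 +
      ws.2 * (xpoint z b).1, (xpoint z b).2))
  (q \o strip_point (Xidx b))).
- apply: within_continuous_pair; last first.
    by apply: continuous_within => ws; exact: cvg_cst.
  have c1 : {within seam b `*` I01, continuous
      (fun ws : Z * R => (coords (side_section (b, true) ws.1)).1)}.
    apply: (@within_continuous_comp_sub _ _ _ _ setT
      (fun ws : Z * R => side_section (b, true) ws.1)
      (fun p => (coords p).1)) => //.
      apply: (@within_continuous_comp_sub _ _ _ _ (seam b) fst) => //.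
      + by apply: continuous_within => ws; exact: cvg_fst.
      + by move=> ws [].
      + exact: (@side_section_continuous (b, true)).
    apply: continuous_within => p.
    apply: (@continuous_comp _ _ _ coord fst).
      exact: coords_continuous.
    exact: cvg_fst.
  have c2 : {within seam b `*` I01, continuous (fun ws : Z * R => ws.2)}.
    by apply: continuous_within => ws; exact: cvg_snd.
  apply/subspace_continuousP => ws Aws.
  move/subspace_continuousP/(_ ws Aws) : c1 => c1.
  move/subspace_continuousP/(_ ws Aws) : c2 => c2.
  apply: cvgD; apply: cvgM => //; last exact: cvg_cst.
  by apply: cvgB => //; exact: cvg_cst.
- move=> [w s] [/= bw]; rewrite in_itv /= => s01.
  by have [] := @side_interval_sub (b, true) _ (seam_contraction_line bw s01).
- apply: (@within_continuous_comp_sub _ _ _ _ setT) => //.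
    exact: strip_point_continuous.
  exact/continuous_within/atlas_map_continuous.
Qed.

(* The seam contraction read in the coordinates of the side [i]. *)
Definition slide i u s : R * R :=
  coords (side_section i
    (seam_contraction i.1 (q (strip_point (side_strip i) u)) s)).

Lemma slide_interval i u s : side_interval i u -> 0 <= s <= 1 ->
  side_interval i (slide i u s).
Proof.
move=> iu s01; have bu := side_family_map (strip_point_family iu).
by have [[]] := side_sectionP (seam_contraction_seam bu s01).
Qed.

Lemma slide_map i u s : side_interval i u -> 0 <= s <= 1 ->
  q (strip_point (side_strip i) (slide i u s)) =
  seam_contraction i.1 (q (strip_point (side_strip i) u)) s.
Proof.
move=> iu s01; have bu := side_family_map (strip_point_family iu).
have [[eX _] qX] := side_sectionP (seam_contraction_seam bu s01).
rewrite /slide; move: (side_section i _) eX qX => p <- <-.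
by rewrite strip_point_coords.
Qed.

Lemma slide0 i u : side_interval i u -> slide i u 0 = u.
Proof.
move=> iu; have fu := strip_point_family iu; have [Su _] := side_interval_sub iu.
rewrite /slide seam_contraction0; last exact: side_family_map.
by rewrite side_sectionK // coords_strip_point.
Qed.

Lemma slide1 i u : side_interval i u -> slide i u 1 = side_point i.
Proof.
move=> iu; have [iz Sz qz _] := side_pointP i.
rewrite /slide seam_contraction1 -qz side_sectionK ?coords_strip_point //.
exact: strip_point_family.
Qed.

(** On a Y side this motion need not be linear: it is the linear motion of X transported by the
    gluing. Continuity therefore goes through the seam and back by the continuous section. *)
Lemma slide_continuous i : {within side_interval i `*` I01,
  continuous (fun us : (R * R) * R => slide i us.1 us.2)}.
Proof.
pose k (us : (R * R) * R) := (q (strip_point (side_strip i) us.1), us.2).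
have kA us : (side_interval i `*` I01) us -> (seam i.1 `*` I01) (k us).
  by move=> [iu ?]; split => //; exact/side_family_map/strip_point_family.
apply: (@within_continuous_comp_sub _ _ _ _ setT
  (fun us : (R * R) * R => side_section i
    (seam_contraction i.1 (q (strip_point (side_strip i) us.1)) us.2))
  coord) => //; last exact/continuous_within/coords_continuous.
apply: (@within_continuous_comp_sub _ _ _ _ (seam i.1)
  (fun us : (R * R) * R =>
    (seam_contraction i.1 (q (strip_point (side_strip i) us.1)) us.2))).
- apply: (within_continuous_comp_sub _ kA (@seam_contraction_continuous i.1)).
  apply: within_continuous_pair; last first.
    by apply: continuous_within => us; exact: cvg_snd.
  apply: (@within_continuous_comp_sub _ _ _ _ setT
    (fun us : (R * R) * R => strip_point (side_strip i) us.1) q) => //; last first.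
    exact/continuous_within/atlas_map_continuous.
  apply: (@within_continuous_comp_sub _ _ _ _ (strip (side_strip i)) fst).
  + by apply: continuous_within => us; exact: cvg_fst.
  + by move=> us [/side_interval_sub[]].
  + exact: strip_point_continuous.
- move=> us [iu]; rewrite /= in_itv /= => s01.
  exact/seam_contraction_seam/s01/side_family_map/strip_point_family.
- exact: side_section_continuous.
Qed.

End seam_sides.

(** * The homotopy inverse *)

Section arms.
Context {R : realType} {Z : topologicalType} (At : striped_atlas R Z).
Context (z : seam_points At).
Notation q := (@atlas_map R Z At).
Notation strips := (strips (@strip R Z At)).
Notation side := (seam_index At * bool)%type.
Implicit Types (b : seam_index At) (i : side) (h t : R).

Lemma clampN11_subproof t :
  Num.max (-1) (Num.min 1 t) \in (`[-1, 1]%classic : set R).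
Proof.
rewrite inE /= in_itv /=.
by case: (leP (-1) (Num.min 1 t)); case: (leP 1 t); lra.
Qed.

(** Lets edges be parametrised by all real numbers instead of a subtype. *)
Definition clampN11 t : `[-1, 1]%classic : set R :=
  exist _ (Num.max (-1) (Num.min 1 t)) (clampN11_subproof t).

Lemma clampN11_continuous : continuous clampN11.
Proof.
apply: continuous_comp_initial => t.
apply: cvg_maxr; first exact: cvg_cst.
by apply: cvg_minr; [exact: cvg_cst | exact: cvg_id].
Qed.

Lemma clampN11_val (t : `[-1, 1]%classic : set R) : clampN11 (\val t) = t.
Proof.
case: t => t ht; apply: val_inj => /=; have := set_mem ht; rewrite /= in_itv /=.
by case: (leP (-1) (Num.min 1 t)); case: (leP 1 t); lra.
Qed.

Lemma val_clampN11 t : -1 <= t <= 1 -> \val (clampN11 t) = t.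
Proof.
by rewrite /=; case: (leP (-1) (Num.min 1 t)); case: (leP 1 t); lra.
Qed.

Definition edge_at b t : graph At := edge b (clampN11 t).

Lemma edge_at_continuous b : continuous (edge_at b).
Proof.
move=> t; apply: (@continuous_comp _ _ _ clampN11 (edge b)).
  exact: clampN11_continuous.
apply: (@continuous_comp _ _ _ (@edge_cell R Z At b) (\pi_(graph At))%qT).
  exact: (@existT_continuous _ (@cell R Z At) (inr b)).
exact: pi_continuous.
Qed.

Lemma edge_atN1 b : edge_at b (-1) = vertex (Xidx b).
Proof.
apply/eqmodP/eqP; rewrite /attach /= ifT //.
by rewrite min_r ?max_l //; lra.
Qed.

Lemma edge_at1 b : edge_at b 1 = vertex (Yidx b).
Proof.
apply/eqmodP/eqP; rewrite /attach /= min_l // max_r; last lra.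
by rewrite ifF ?eqxx //; apply/eqP; lra.
Qed.

Lemma edge_at_val b (t : `[-1, 1]%classic : set R) : edge_at b (\val t) = edge b t.
Proof. by rewrite /edge_at clampN11_val. Qed.

Lemma graph_map_edge_at b t : -1 <= t <= 1 ->
  graph_map z (edge_at b t) = edge_map z b t.
Proof. by move=> t1; rewrite graph_map_edge val_clampN11. Qed.

(* The half of the edge [i.1] that starts at the vertex of the side [i],
   parametrised by [0, 1]. *)
Definition arm i h : graph At := edge_at i.1 (if i.2 then h - 1 else 1 - h).

(** The path in the strip followed by the canonical injection along an arm: obliquely from the
    origin until [h = 1/2], then vertically up to the chosen seam point. *)
Definition spoke i h : R * R :=
  (Num.min 1 (2 * h) * (side_point z i).1, h * (side_point z i).2).

Lemma arm0 i : arm i 0 = vertex (side_strip i).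
Proof.
rewrite /arm; case: i => b [] /=.
  by rewrite sub0r edge_atN1.
by rewrite subr0 edge_at1.
Qed.

Lemma arm1 i : arm i 1 = edge_at i.1 0.
Proof. by rewrite /arm subrr; case: ifP. Qed.

Lemma arm_continuous i : continuous (arm i).
Proof.
move=> h; apply: (@continuous_comp _ _ _ (fun h => if i.2 then h - 1 else 1 - h));
  last exact: edge_at_continuous.
by case: i => b [] /=; apply: cvgB; (exact: cvg_cst || exact: cvg_id).
Qed.

Lemma spoke_continuous i : continuous (spoke i).
Proof.
apply: continuous_pair => h; apply: cvgM; try exact: cvg_cst; last exact: cvg_id.
apply: cvg_minr; first exact: cvg_cst.
by apply: cvgM; [exact: cvg_cst | exact: cvg_id].
Qed.

Lemma graph_map_arm i h : 0 <= h <= 1 ->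
  graph_map z (arm i h) = q (strip_point (side_strip i) (spoke i h)).
Proof.
move=> h01; rewrite /arm graph_map_edge_at; last by case: ifP; lra.
have [_ _ qx _] := @xpointP _ _ _ z i.1; have [_ _ qy _] := @ypointP _ _ _ z i.1.
rewrite /edge_map /spoke /side_strip /side_point.
move: qx qy; case: i => b [] /=;
  case: (xpoint z b) (ypoint z b) => x e [y e'] /= qx qy.
- case: (leP (h - 1)) => h1.
    by rewrite min_r; [congr (q (strip_point _ (_, _))); lra | lra].
  rewrite ifT; last lra.
  by rewrite min_l; [congr (q (strip_point _ (_, _))); lra | lra].
- rewrite ifF; last by apply/negbTE; lra.
  (* At the midpoint [edge_map] uses its X branch even for a Y side; both branches give [z b]
     there. *)
  case: (leP (1 - h) 0) => h0.
    have -> : h = 1 by lra.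
    by rewrite min_l ?subrr ?addr0 ?mul1r ?qx ?qy //; lra.
  case: (leP (1 - h)) => h1.
    by rewrite min_l; [congr (q (strip_point _ (_, _))); lra | lra].
  by rewrite min_r; [congr (q (strip_point _ (_, _))); lra | lra].
Qed.

End arms.

(** * The collapse of one strip onto its vertex and arms *)

Section collar_map.
Context {R : realType} {Z : topologicalType} (At : striped_atlas R Z).
Context (z : seam_points At).
Notation q := (@atlas_map R Z At).
Notation strips := (strips (@strip R Z At)).
Notation side := (seam_index At * bool)%type.
Notation coord := (@coords R _ (@strip R Z At)).
Implicit Types (a : strip_index At) (b : seam_index At) (i : side).
Implicit Types (u : R * R) (h s t e y : R) (p : strips).

(** The value at 0 is immaterial, since heights vanish for [|y| <= 1/2]. *)
Definition sgn y : R := if 0 <= y then 1 else -1.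

Lemma sgn_unit y : sign_unit (sgn y).
Proof. by rewrite /sgn; case: ifP; [right | left]. Qed.

Lemma sgn_norm y : sgn y * y = `|y|.
Proof.
rewrite /sgn; case: ifP => y0; first by rewrite mul1r ger0_norm.
by rewrite mulN1r ler0_norm //; lra.
Qed.

Lemma sgn_mul e t : sign_unit e -> 0 < t -> sgn (t * e) = e.
Proof.
rewrite /sgn => -[] -> t0; last by rewrite ifT //; lra.
by rewrite ifF //; apply/negbTE; lra.
Qed.

Lemma sign_unit_id e : sign_unit e -> sgn e = e.
Proof. by move=> he; rewrite -[X in sgn X]mul1r sgn_mul. Qed.

Lemma sgn_near y : y != 0 -> \forall y' \near y, sgn y' = sgn y.
Proof.
case: (ltgtP y 0) => // y0 _; near=> y'; rewrite /sgn.
- have y'0 : y' < 0 by near: y'; exact: lt_nbhsl.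
  by rewrite !leNgt y0 y'0.
- have y'0 : 0 < y' by near: y'; exact: lt_nbhsr.
  by rewrite !ltW.
Unshelve. all: by end_near. Qed.

Definition foot u : R * R := (u.1, sgn u.2).

Lemma foot_id u : `|u.2| = 1 -> foot u = u.
Proof.
move=> u1; rewrite /foot [RHS]surjective_pairing; congr (_, _).
by move: u1; rewrite -sgn_norm /sgn; case: ifP => _ ?; lra.
Qed.

(** The glued side facing [u]; [None] covers feet outside the strip as well as feet on unglued
    boundary intervals. The choice is unique by [side_interval_inj]. *)
Definition label a u : option side :=
  match pselect (exists i, side_strip i = a /\ side_interval i (foot u)) with
  | left ex => Some (projT1 (cid ex))
  | right _ => None
  end.

Lemma labelP a u i : label a u = Some i ->
  side_strip i = a /\ side_interval i (foot u).
Proof.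
by rewrite /label; case: pselect => // ex [<-]; exact: (projT2 (cid ex)).
Qed.

Lemma label_some a u i : side_strip i = a -> side_interval i (foot u) ->
  label a u = Some i.
Proof.
move=> ia iu; rewrite /label; case: pselect => [ex|[]]; last by exists i.
case: cid => j /= [ja ju]; congr Some.
by apply: side_interval_inj ju iu; rewrite ja ia.
Qed.

Lemma eq_label a u u' :
  (forall i, side_strip i = a ->
     side_interval i (foot u) <-> side_interval i (foot u')) ->
  label a u = label a u'.
Proof.
move=> uu'; case lu : (label a u) => [i|].
  have [ia iu] := labelP lu.
  by apply/esym/label_some => //; apply/uu'.
case lu' : (label a u') => [i|//].
have [ia iu] := labelP lu'.
by rewrite (label_some ia) in lu => //; apply/uu'.
Qed.

Definition collar_height a u : R := height (strip a) (sgn u.2) u.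

Lemma strip_norm a u : strip a u -> `|u.2| <= 1.
Proof. by have [S1 _ _] := stripP a; move=> /S1 /=; rewrite ler_norml. Qed.

Lemma collar_height_itv a u : strip a u -> 0 <= collar_height a u <= 1.
Proof. by move=> Su; apply: height_itv; rewrite sgn_norm; exact: strip_norm Su. Qed.

Lemma collar_height_lt1 a u : `|u.2| < 1 -> collar_height a u < 1.
Proof. by move=> u1; apply: height_lt1; rewrite sgn_norm. Qed.

Lemma collar_height_eq1 a u : strip a u -> `|u.2| = 1 -> collar_height a u = 1.
Proof.
move=> Su u1; apply: height_eq1; [exact: stripP | exact: sgn_unit | |].
- by rewrite -[(_, _)]/(foot u) foot_id.
- by rewrite sgn_norm.
Qed.

(* Since S_a is open in the closed strip, the collars of its boundary intervals
   form a locally finite family in S_a. *)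
Lemma collar_near a u : strip a u ->
  (\forall v \near u, collar_height a v = 0) \/
  [/\ strip a (foot u), 0 < depth (strip a) (sgn u.2) u.1 &
      \forall v \near u, sgn v.2 = sgn u.2 /\ label a v = label a u].
Proof.
move=> Su; have c2 : (fun v : R * R => `|v.2|) @ u --> `|u.2|.
  by apply: cvg_norm; exact: cvg_snd.
have [u_low|u_high] := ltP `|u.2| 2^-1.
  left; near=> v; apply: height_low; rewrite sgn_norm ltW //.
  by near: v; exact: (cvgr_lt _ c2).
have u0 : u.2 != 0 by rewrite -normr_gt0; lra.
have sgnE : \forall v \near u, sgn v.2 = sgn u.2.
  exact: (@cvg_snd _ _ _ _ _ _ (sgn_near u0)).
have [Sf|Sf] := pselect (strip a (foot u)); last first.
  left; have d0 : depth (strip a) (sgn u.2) u.1 = 0 by exact: depth_out.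
  have u1 : `|u.2| < 1.
    rewrite lt_neqAle (strip_norm Su) andbT; apply/eqP => u1; apply: Sf.
    by rewrite foot_id.
  have cd : (fun v : R * R => depth (strip a) (sgn u.2) v.1) @ u --> (0 : R).
    rewrite -d0; apply: (@continuous_comp _ _ _ fst (depth (strip a) (sgn u.2))).
      exact: cvg_fst.
    exact: depth_continuous.
  (* Half of the gap to the side: near [u] the depth stays below it and the distance to the side
     above it, so the height is 0. *)
  have m0 : 0 < (1 - `|u.2|) / 2 by lra.
  near=> v; have ev : sgn v.2 = sgn u.2 by near: v.
  apply: height_eq0; rewrite sgn_norm ev.
  have h1 : depth (strip a) (sgn u.2) v.1 < (1 - `|u.2|) / 2.
    by near: v; exact: (cvgr_lt _ cd).
  have h2 : `|v.2| < (1 + `|u.2|) / 2.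
    by near: v; apply: (cvgr_lt _ c2); lra.
  by apply: ltW; apply: lt_trans h1 _; lra.
right; split => //.
  by apply: depth_gt0 => //; [exact: stripP | exact: sgn_unit].
(* Nearby feet lie in the same boundary component, so the label is locally constant. *)
have nb := strip_boundary_near (stripP a) (sgn_unit u.2) Sf.
near=> v; have ev : sgn v.2 = sgn u.2 by near: v.
split => //; apply: eq_label => i ia.
have cv : connected_component (strip_boundary (strip a)) (foot u) (foot v).
  rewrite /foot ev; near: v.
  exact: (@cvg_fst _ _ _ _ _ _ nb).
have := side_interval_boundary i; rewrite ia => hi; split=> [iv|iu].
- rewrite (boundary_intervalE hi iv); exact: connected_component_sym.
- by rewrite (boundary_intervalE hi iu).
Unshelve. all: by end_near. Qed.

Definition collar_map a u : graph At :=
  if label a u is Some i then arm i (collar_height a u) else vertex a.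

Lemma collar_map_flat a u : collar_height a u = 0 -> collar_map a u = vertex a.
Proof.
rewrite /collar_map => ->; case lu : (label a u) => [i|//].
by rewrite arm0 (labelP lu).1.
Qed.

Lemma collar_height_continuous a u : strip a u ->
  0 < depth (strip a) (sgn u.2) u.1 ->
  (\forall v \near u, sgn v.2 = sgn u.2) ->
  {for u, continuous (collar_height a)}.
Proof.
move=> Su d0 ne; apply: near_eq_continuous (height_continuous d0).
by apply: filterS ne => v ev; rewrite /collar_height ev.
Qed.

(** By [collar_near], the map is locally either constant at the vertex or one fixed arm composed
    with the height. *)
Lemma collar_map_continuous a u : strip a u -> {for u, continuous (collar_map a)}.
Proof.
move=> Su; have [h0|[Sf d0 nl]] := collar_near Su.
  apply: (@near_eq_continuous _ _ (cst (vertex a))); last exact: cvg_cst.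
  by apply: filterS h0 => v hv; rewrite collar_map_flat.
have ns : \forall v \near u, sgn v.2 = sgn u.2.
  by apply: filterS nl => v [].
have ch := collar_height_continuous Su d0 ns.
case lu : (label a u) nl => [i|] nl.
  apply: (@near_eq_continuous _ _ (arm i \o collar_height a)).
    by apply: filterS nl => v [_ lv]; rewrite /collar_map lv.
  by apply: continuous_comp; [exact: ch | exact: arm_continuous].
apply: (@near_eq_continuous _ _ (cst (vertex a))); last exact: cvg_cst.
by apply: filterS nl => v [_ lv]; rewrite /collar_map lv.
Qed.

End collar_map.

(** * The homotopy on one strip from the identity to a lift of the composite *)

Section strip_homotopy.
Context {R : realType} {Z : topologicalType} (At : striped_atlas R Z).
Context (z : seam_points At).
Notation q := (@atlas_map R Z At).
Notation strips := (strips (@strip R Z At)).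
Notation side := (seam_index At * bool)%type.
Notation coord := (@coords R _ (@strip R Z At)).
Implicit Types (a : strip_index At) (b : seam_index At) (i : side).
Implicit Types (u : R * R) (h s t e y : R) (p : strips).

(* The first coordinate on the collar of the side [i]: it agrees with the seam
   contraction on the side itself, where [h = 1], and it is affine in [s] on the
   half of the collar where [h <= 1/2]. *)
Definition collar_homotopy i h u s : R * R :=
  let m := Num.max 0 (2 * h - 1) in
  (m * (slide z i (foot u) s).1 +
     (1 - m) * ((1 - s) * u.1 + s * (spoke z i h).1),
   (1 - s) * u.2 + s * (spoke z i h).2).

Definition strip_homotopy a u s : R * R :=
  if label a u is Some i then collar_homotopy i (collar_height a u) u s
  else ((1 - s) * u.1, (1 - s) * u.2).

(** At height 0 the formula forgets the side and agrees with the unlabelled contraction to the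
    origin, so the pieces fit at the rim of a collar. *)
Lemma collar_homotopy_low i u s :
  collar_homotopy i 0 u s = ((1 - s) * u.1, (1 - s) * u.2).
Proof.
rewrite /collar_homotopy /spoke /= mulr0 min_r // max_l; last lra.
by congr (_, _); lra.
Qed.

Lemma strip_homotopy0 a u : strip_homotopy a u 0 = u.
Proof.
rewrite /strip_homotopy; case lu : (label a u) => [i|]; last first.
  by rewrite subr0 !mul1r -surjective_pairing.
have [_ iu] := labelP lu.
rewrite /collar_homotopy slide0 // [RHS]surjective_pairing /=.
by congr (_, _); lra.
Qed.

Lemma strip_homotopy1 a u : strip a u ->
  q (strip_point a (strip_homotopy a u 1)) = graph_map z (collar_map a u).
Proof.
move=> Su; rewrite /strip_homotopy /collar_map.
case lu : (label a u) => [i|]; last first.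
  by rewrite graph_map_vertex subrr !mul0r.
have [ia iu] := labelP lu.
rewrite graph_map_arm; last exact: collar_height_itv.
rewrite ia; congr (q (strip_point a _)).
rewrite /collar_homotopy slide1 // /spoke /=; set h := collar_height a u.
(* For [h <= 1/2] the weight [m] is 0; beyond, the spoke already has the first coordinate of the
   seam point, so the weight has no effect. *)
have [h2|h2] := leP (2 * h - 1) 0.
  by congr (_, _); lra.
by rewrite min_l; [congr (_, _); lra | lra].
Qed.

(** At height 1 the weight [m] is 1, so the first coordinate is that of the slide; the second is
    constant because the interval lies on one side of the strip. *)
Lemma strip_homotopy_boundary a u i s : strip a u -> 0 <= s <= 1 ->
  `|u.2| = 1 -> label a u = Some i ->
  strip_homotopy a u s = slide z i u s.
Proof.
move=> Su s01 u1 lu; have [ia iu] := labelP lu.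
rewrite /strip_homotopy lu (collar_height_eq1 Su u1) /collar_homotopy.
rewrite max_r; last lra.
rewrite (foot_id u1) in iu *; rewrite [RHS]surjective_pairing /=.
congr (_, _); first lra.
have hi := side_interval_boundary i.
have [iz _ _ _] := side_pointP z i.
rewrite -(boundary_interval_side hi iu (slide_interval z iu s01)).
by rewrite -(boundary_interval_side hi iu iz); lra.
Qed.

Lemma strip_homotopy_strip a u s : strip a u -> 0 <= s <= 1 ->
  strip a (strip_homotopy a u s).
Proof.
move=> Su s01; have u1 := strip_norm Su.
have [u1'|u1'] := eqVneq `|u.2| 1.
  case lu : (label a u) => [i|].
    rewrite (strip_homotopy_boundary Su s01 u1' lu).
    have [ia iu] := labelP lu.
    rewrite foot_id // in iu.
    have [+ _] := side_interval_sub (slide_interval z iu s01).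
    by rewrite ia.
  (* An unglued boundary point enters the interior of the strip as soon as [s > 0]. *)
  have [->|s0] := eqVneq s 0; first by rewrite strip_homotopy0.
  rewrite /strip_homotopy lu; apply: strip_interior => /=.
  have {}s0 : 0 < s by rewrite lt_neqAle eq_sym s0; case/andP: s01.
  by move: u1; rewrite ler_norml => /andP[? ?]; apply/andP; split; nra.
have {}u1' : `|u.2| < 1 by rewrite lt_neqAle u1'.
have h1 := collar_height_lt1 a u1'; have h01 := collar_height_itv Su.
apply: strip_interior; rewrite /strip_homotopy.
move: u1'; rewrite ltr_norml => /andP[ul ur].
case lu : (label a u) => [i|] /=; last by apply/andP; split; nra.
have [_ _ _ he] := side_pointP z i.
set k := collar_height a u * _.
have k1 : -1 < k < 1.
  by rewrite /k; move: (collar_height a u) h1 h01 => h h1 h01; case: he => ->; lra.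
move: (u.2) (k) ul ur k1 s01 => y c yl yr /andP[cl cr] /andP[s0 s1].
(* A convex combination of two numbers in (-1, 1); in each case one of the weights is at least 1/2,
   which preserves strictness. *)
by have [s2|s2] := leP s 2^-1; apply/andP; split; nra.
Qed.

Lemma strip_homotopy_continuous a u s : strip a u ->
  {for (u, s), continuous
    (fun us : (R * R) * R => strip_homotopy a us.1 (clamp us.2))}.
Proof.
move=> Su.
pose T := ((R * R) * R)%type.
have cf : {for (u, s), continuous (fst : T -> R * R)} by exact: cvg_fst.
have cs : {for (u, s), continuous (@clamp R \o (snd : T -> R))}.
  by apply: continuous_comp; [exact: cvg_snd | exact: clamp_continuous].
have c1s : {for (u, s), continuous (fun us : T => 1 - clamp us.2 : R)}.
  by apply: cvgB; [exact: cvg_cst | exact: cs].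
have c1 : {for (u, s), continuous (fst \o (fst : T -> R * R))}.
  by apply: continuous_comp; [exact: cf | exact: cvg_fst].
have c2 : {for (u, s), continuous (snd \o (fst : T -> R * R))}.
  by apply: continuous_comp; [exact: cf | exact: cvg_snd].
have cflat : {for (u, s), continuous (fun us : T =>
    ((1 - clamp us.2) * us.1.1, (1 - clamp us.2) * us.1.2))}.
  by apply: pair_continuous_at; apply: cvgM; try exact: c1s;
    [exact: c1 | exact: c2].
have [h0|[Sf d0 nl]] := collar_near Su.
  apply: near_eq_continuous cflat.
  have h0' : \forall us \near (u, s), collar_height a us.1 = 0 by exact: cf _ h0.
  apply: filterS h0' => us hu; rewrite /strip_homotopy.
  by case: (label a us.1) => // i; rewrite hu collar_homotopy_low.
have nl' : \forall us \near (u, s), sgn us.1.2 = sgn u.2 /\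
  label a us.1 = label a u by exact: cf _ nl.
case lu : (label a u) nl nl' => [i|] nl nl'; last first.
  apply: near_eq_continuous cflat.
  by apply: filterS nl' => us [_ lv]; rewrite /strip_homotopy lv.
have ns : \forall v \near u, sgn v.2 = sgn u.2.
  by apply: filterS nl => v [].
have ch : {for (u, s), continuous (collar_height a \o (fst : T -> R * R))}.
  by apply: continuous_comp; [exact: cf | exact: collar_height_continuous].
have csp : {for (u, s), continuous
    (spoke z i \o (collar_height a \o (fst : T -> R * R)))}.
  by apply: continuous_comp; [exact: ch | exact: spoke_continuous].
have csp1 : {for (u, s), continuous
    (fst \o (spoke z i \o (collar_height a \o (fst : T -> R * R))))}.
  by apply: continuous_comp; [exact: csp | exact: cvg_fst].
have csp2 : {for (u, s), continuous
    (snd \o (spoke z i \o (collar_height a \o (fst : T -> R * R))))}.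
  by apply: continuous_comp; [exact: csp | exact: cvg_snd].
have cm : {for (u, s), continuous
    (fun us : T => Num.max 0 (2 * collar_height a us.1 - 1) : R)}.
  apply: cvg_maxr; first exact: cvg_cst.
  apply: cvgB; last exact: cvg_cst.
  by apply: cvgM; [exact: cvg_cst | exact: ch].
(* The sign of the foot is frozen at that of [u], which is legitimate near [u]; the constant label
   keeps the foot in the interval where [slide] is continuous. *)
have csl : {for (u, s), continuous (fun us : T =>
    slide z i (us.1.1, sgn u.2) (clamp us.2))}.
  apply: (within_comp_continuous (f := fun us : T =>
    ((us.1.1, sgn u.2), clamp us.2)) (@slide_continuous _ _ _ z i)).
    apply: pair_continuous_at; last exact: cs.
    by apply: pair_continuous_at; [exact: c1 | exact: cvg_cst].
  apply: filterS nl' => us [sv lv]; split; last exact: I01_clamp.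
  by have [_] := labelP lv; rewrite /foot sv.
have csl1 : {for (u, s), continuous (fst \o (fun us : T =>
    slide z i (us.1.1, sgn u.2) (clamp us.2)))}.
  by apply: continuous_comp; [exact: csl | exact: cvg_fst].
apply: (@near_eq_continuous _ _ (fun us : T =>
  let m := Num.max 0 (2 * collar_height a us.1 - 1) in
  (m * (slide z i (us.1.1, sgn u.2) (clamp us.2)).1 +
     (1 - m) * ((1 - clamp us.2) * us.1.1 +
                clamp us.2 * (spoke z i (collar_height a us.1)).1),
   (1 - clamp us.2) * us.1.2 +
     clamp us.2 * (spoke z i (collar_height a us.1)).2))).
  apply: filterS nl' => us [sv lv].
  by rewrite /strip_homotopy lv /collar_homotopy /foot sv.
apply: pair_continuous_at; apply: cvgD; apply: cvgM.
- exact: cm.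
- exact: csl1.
- by apply: cvgB; [exact: cvg_cst | exact: cm].
- apply: cvgD; apply: cvgM.
  + exact: c1s.
  + exact: c1.
  + exact: cs.
  + exact: csp1.
- exact: c1s.
- exact: c2.
- exact: cs.
- exact: csp2.
Qed.

End strip_homotopy.

(** * Descent to the surface and to the graph *)

Section homotopy_inverse.
Context {R : realType} {Z : topologicalType} (At : striped_atlas R Z).
Context (z : seam_points At).
Notation q := (@atlas_map R Z At).
Notation strips := (strips (@strip R Z At)).
Notation side := (seam_index At * bool)%type.
Notation coord := (@coords R _ (@strip R Z At)).
Implicit Types (a : strip_index At) (b : seam_index At) (i : side).
Implicit Types (u : R * R) (h s t : R) (p : strips) (w : Z).

Lemma side_family_label i p : side_family i p ->
  `|(coord p).2| = 1 /\ label (projT1 p) (coord p) = Some i.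
Proof.
move=> [ei ip]; have [_ h1] := side_interval_sub ip.
split; first by case: h1 => ->; rewrite ?normrN normr1.
apply: label_some => //.
by rewrite /foot (sign_unit_id h1) -surjective_pairing.
Qed.

Definition strips_collar_map p : graph At := collar_map (projT1 p) (coord p).

(** Both sides of a seam go to the midpoint of its edge, which is why the collapse descends to the
    surface. *)
Lemma strips_collar_map_side i p : side_family i p ->
  strips_collar_map p = edge_at i.1 0.
Proof.
move=> ip; have [p1 lp] := side_family_label ip.
rewrite /strips_collar_map /collar_map lp collar_height_eq1 ?arm1 //.
exact: strip_coords.
Qed.

Lemma strips_collar_map_eq p p' : q p = q p' ->
  strips_collar_map p = strips_collar_map p'.
Proof.
move=> /atlas_map_eq[->//|[i [i' [ii' ip ip']]]].
by rewrite (strips_collar_map_side ip) (strips_collar_map_side ip') ii'.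
Qed.

Lemma atlas_map_surj w : exists p, q p = w.
Proof.
by have [qT _] := atlas_map_quotient At; have [p _ <-] : range q w;
  [rewrite qT | exists p].
Qed.

Definition atlas_lift w : strips := projT1 (cid (atlas_map_surj w)).

Lemma atlas_liftK w : q (atlas_lift w) = w.
Proof. exact: projT2 (cid (atlas_map_surj w)). Qed.

(** The lift is an arbitrary choice; [strips_collar_map_eq] makes the value independent of it. *)
Definition surface_map w : graph At := strips_collar_map (atlas_lift w).

Lemma surface_mapE p : surface_map (q p) = strips_collar_map p.
Proof. by apply: strips_collar_map_eq; rewrite atlas_liftK. Qed.

Lemma surface_map_continuous : continuous surface_map.
Proof.
apply: (quotient_map_continuous (atlas_map_quotient At)).
rewrite (_ : _ \o _ = strips_collar_map); last exact/funext/surface_mapE.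
apply: (@sigT_continuous _ _ _ (fun a (u : strip_space (strip a)) =>
  collar_map a (\val u))) => a u.
apply: (@continuous_comp _ _ _ (\val : strip_space (strip a) -> R * R)).
  exact: initial_continuous.
exact/collar_map_continuous/set_valP.
Qed.

Definition strips_homotopy (ps : strips * R) : Z :=
  q (strip_point (projT1 ps.1)
      (strip_homotopy z (projT1 ps.1) (coord ps.1) (clamp ps.2))).

(** The right-hand side depends only on the seam and on the image of [p], so the homotopy agrees on
    glued points. *)
Lemma strips_homotopy_side i p s : side_family i p ->
  strips_homotopy (p, s) = seam_contraction z i.1 (q p) (clamp s).
Proof.
move=> ip; have [p1 lp] := side_family_label ip; have s01 := clamp_itv s.
rewrite /strips_homotopy /= (strip_homotopy_boundary z _ s01 p1 lp); last first.
  exact: strip_coords.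
case: ip => ei ii; rewrite ei slide_map // -[in LHS]ei.
by rewrite strip_point_coords.
Qed.

Lemma strips_homotopy_eq p p' s : q p = q p' ->
  strips_homotopy (p, s) = strips_homotopy (p', s).
Proof.
move=> qp; have [->//|[i [i' [ii' ip ip']]]] := atlas_map_eq qp.
by rewrite (strips_homotopy_side _ ip) (strips_homotopy_side _ ip') ii' qp.
Qed.

(** Continuity in the plane is transferred to the strip: [q \o strip_point a] is continuous only
    within the strip, and [strip_homotopy_strip] keeps the motion there. *)
Lemma strips_homotopy_continuous : continuous strips_homotopy.
Proof.
move=> [[a u] s]; pose k (us : (R * R) * R) :=
  strip_homotopy z a us.1 (clamp us.2).
have Su : strip a (\val u) by exact: set_valP.
have cs : {within strip a, continuous (q \o strip_point a)}.
  apply: (@within_continuous_comp_sub _ _ _ _ setT) => //.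
    exact: strip_point_continuous.
  exact/continuous_within/atlas_map_continuous.
move=> W nW.
have nV : within (strip a) (nbhs (k (\val u, s))) ((q \o strip_point a) @^-1` W).
  move/subspace_continuousP : cs; apply => //.
  exact/strip_homotopy_strip/clamp_itv.
have [[A B] /= [nA nB] AB] := @strip_homotopy_continuous _ _ _ z a (\val u) s Su _ nV.
pose ex (v : strip_space (strip a)) : strips :=
  existT (fun a => strip_space (strip a)) a v.
exists (ex @` (\val @^-1` A), B).
  split => //=.
  apply: (@existT_nbhs _ (fun a => strip_space (strip a)) a u (\val @^-1` A)).
  exact: (@initial_continuous (set_type (strip a)) _ set_val u A nA).
move=> [p t] [/= [v Av <-] Bt].
apply: (AB (\val v, t)) => //.
by apply: strip_homotopy_strip; [exact: set_valP | exact: clamp_itv].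
Qed.

Lemma graph_map_surface_map_homotopic :
  homotopic R (graph_map z \o surface_map) id.
Proof.
pose H (ws : Z * R) := strips_homotopy (atlas_lift ws.1, ws.2).
have HE p s : H (q p, s) = strips_homotopy (p, s).
  by apply: strips_homotopy_eq; rewrite atlas_liftK.
have cH : continuous H.
  apply: (quotient_map_prod_continuous (atlas_map_quotient At)).
  rewrite (_ : (fun _ => _) = strips_homotopy).
    exact: strips_homotopy_continuous.
  by apply/funext => -[p s]; rewrite HE.
(* Time is reversed because the strip homotopy starts at the identity. *)
apply: (@homotopic_of_continuous _ _ _ _ _ (H \o (fun ws => (ws.1, 1 - ws.2)))).
- move=> ws; apply: continuous_comp; last exact: cH.
  apply: (continuous_pair (fun x => @cvg_fst _ _ _ _ _)) => x.
  by apply: cvgB; [exact: cvg_cst | exact: cvg_snd].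
- move=> w; have [p <-] := atlas_map_surj w.
  rewrite /= HE surface_mapE /strips_homotopy /= subr0 clamp_ge1 //.
  by rewrite strip_homotopy1 //; exact: strip_coords.
- move=> w; have [p <-] := atlas_map_surj w.
  rewrite /= HE /strips_homotopy /= subrr clamp_le0 //.
  by rewrite strip_homotopy0 strip_point_coords.
Qed.

(* [surface_map] after [graph_map] acts on the arm of the side [i] as the
   reparametrisation [arm_height i]. *)
Definition arm_height i h : R :=
  height (strip (side_strip i)) (side_point z i).2
    ((side_point z i).1, h * (side_point z i).2).

Lemma arm_height_low i h : h <= 2^-1 -> arm_height i h = 0.
Proof.
move=> h2; apply: height_low; have [_ _ _ he] := side_pointP z i.
by case: he => -> /=; lra.
Qed.

Lemma arm_height_eq1 i : arm_height i 1 = 1.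
Proof.
have [_ Sz _ he] := side_pointP z i.
apply: height_eq1; rewrite /= -?surjective_pairing //; first exact: stripP.
by case: he => -> /=; lra.
Qed.

Lemma arm_height_continuous i : continuous (arm_height i).
Proof.
have [_ Sz _ he] := side_pointP z i; move=> h.
apply: (@continuous_comp _ _ _
  (fun h : R => ((side_point z i).1, h * (side_point z i).2) : R * R)
  (height (strip (side_strip i)) (side_point z i).2)).
  apply: pair_continuous_at; first exact: cvg_cst.
  by apply: cvgM; [exact: cvg_id | exact: cvg_cst].
apply: height_continuous; apply: depth_gt0 => //; first exact: stripP.
by rewrite /= -surjective_pairing.
Qed.

Lemma surface_map_graph_map_arm i h : 0 <= h <= 1 ->
  surface_map (graph_map z (arm i h)) = arm i (arm_height i h).
Proof.
move=> h01; have [iz Sz _ he] := side_pointP z i.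
rewrite graph_map_arm // surface_mapE /strips_collar_map /=.
have [h2|h2] := leP h 2^-1.
  have n2 : `|(spoke z i h).2| <= 2^-1.
    rewrite /spoke /=.
    by case: he => ->; rewrite ?mulr1 ?mulrN1 ?normrN ger0_norm //; lra.
  rewrite coords_strip_point; last first.
    by apply: strip_interior; move: n2; rewrite ler_norml; lra.
  rewrite collar_map_flat; last by apply: height_low; rewrite sgn_norm.
  by rewrite arm_height_low // arm0.
(* Beyond [h = 1/2] the spoke is vertical, so its foot is the seam point and its label is [i]. *)
have spE : spoke z i h = ((side_point z i).1, h * (side_point z i).2).
  by rewrite /spoke min_l ?mul1r //; lra.
have e2 : sgn (spoke z i h).2 = (side_point z i).2.
  by rewrite spE /= sgn_mul //; lra.
have fs : foot (spoke z i h) = side_point z i.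
  by rewrite /foot e2 spE /= -surjective_pairing.
rewrite coords_strip_point; last first.
  by rewrite spE; apply: strip_segment => //; rewrite -surjective_pairing.
rewrite /collar_map (@label_some _ _ _ _ _ i) ?fs //.
by rewrite /collar_height e2 spE.
Qed.

Definition edge_reparam b t : R :=
  if t <= 0 then arm_height (b, true) (1 + t) - 1
  else 1 - arm_height (b, false) (1 - t).

Lemma edge_reparam_continuous b : continuous (edge_reparam b).
Proof.
apply/continuous_subspace_setT.
apply: (within_continuous_cases (k := id)).
- by move=> t; exact: cvg_id.
- exact: closedT.
- apply: continuous_within => t; apply: cvgB; last exact: cvg_cst.
  apply: (@continuous_comp _ _ _ (fun t : R => 1 + t) (arm_height (b, true)));
    last exact: arm_height_continuous.
  by apply: cvgD; [exact: cvg_cst | exact: cvg_id].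
- apply: continuous_within => t; apply: cvgB; first exact: cvg_cst.
  apply: (@continuous_comp _ _ _ (fun t : R => 1 - t) (arm_height (b, false)));
    last exact: arm_height_continuous.
  by apply: cvgB; [exact: cvg_cst | exact: cvg_id].
- by move=> t _ ->; rewrite addr0 subr0 !arm_height_eq1 !subrr.
Qed.

Lemma edge_reparamN1 b : edge_reparam b (-1) = -1.
Proof. by rewrite /edge_reparam ifT ?arm_height_low; lra. Qed.

Lemma edge_reparam1 b : edge_reparam b 1 = 1.
Proof.
rewrite /edge_reparam ifF; last by apply/negbTE; lra.
by rewrite arm_height_low; lra.
Qed.

Lemma surface_map_graph_map_edge b t : -1 <= t <= 1 ->
  surface_map (graph_map z (edge_at b t)) = edge_at b (edge_reparam b t).
Proof.
move=> t1; rewrite /edge_reparam; case: (leP t 0) => t0.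
  have := @surface_map_graph_map_arm (b, true) (1 + t).
  by rewrite /arm /= (addrC 1 t) addrK; apply; lra.
have := @surface_map_graph_map_arm (b, false) (1 - t).
by rewrite /arm /= subKr; apply; lra.
Qed.

Lemma surface_map_graph_map_vertex a :
  surface_map (graph_map z (vertex a)) = vertex a.
Proof.
rewrite graph_map_vertex surface_mapE /strips_collar_map /=.
rewrite coords_strip_point; last by apply: strip_interior => /=; lra.
by apply/collar_map_flat/height_low; rewrite mulr0; lra.
Qed.

(** No bound on the time is needed, as [edge_at] clamps its parameter. *)
Definition cells_homotopy (cs : cells At * R) : graph At :=
  match cs.1 with
  | existT (inl a) _ => vertex a
  | existT (inr b) t =>
      edge_at b ((1 - cs.2) * edge_reparam b (\val t) + cs.2 * \val t)
  end.

(** The reparametrisation fixes both ends of each edge, so the homotopy is stationary at vertices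
    and descends to the graph. *)
Lemma cells_homotopy_attach (c : cells At) s :
  cells_homotopy (attach c, s) = cells_homotopy (c, s).
Proof.
case: c => -[a c|b t] //; rewrite /attach; case: eqP => [tN1|_].
  rewrite /cells_homotopy /= tN1 edge_reparamN1 -edge_atN1.
  by congr edge_at; lra.
case: eqP => [t1|//].
rewrite /cells_homotopy /= t1 edge_reparam1 -edge_at1.
by congr edge_at; lra.
Qed.

Lemma cells_homotopy_continuous : continuous cells_homotopy.
Proof.
move=> [[[a|b] c] s] W nW.
  exists (existT (@cell R Z At) (inl a) @` setT, setT).
    by split; [apply: existT_nbhs; exact: filterT | exact: filterT].
  by move=> [_ t] [/= [c' _ <-] _]; exact: nbhs_singleton nW.
pose k (ts : R * R) := edge_at b ((1 - ts.2) * edge_reparam b ts.1 + ts.2 * ts.1).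
have ck : continuous k.
  move=> ts; apply: (@continuous_comp _ _ _
    (fun ts : R * R => (1 - ts.2) * edge_reparam b ts.1 + ts.2 * ts.1 : R)
    (edge_at b)); last exact: edge_at_continuous.
  apply: cvgD; apply: cvgM.
  - by apply: cvgB; [exact: cvg_cst | exact: cvg_snd].
  - apply: (@continuous_comp _ _ _ fst (edge_reparam b)); first exact: cvg_fst.
    exact: edge_reparam_continuous.
  - exact: cvg_snd.
  - exact: cvg_fst.
have [[A B] /= [nA nB] AB] := ck (\val c, s) W nW.
exists (existT (@cell R Z At) (inr b) @` (\val @^-1` A), B).
  split => //=; apply: existT_nbhs.
  exact: (@initial_continuous _ _ set_val c A nA).
by move=> [_ t] [/= [v Av <-] Bt]; exact: (AB (\val v, t)).
Qed.

Lemma surface_map_graph_map_homotopic :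
  homotopic R (surface_map \o graph_map z) id.
Proof.
pose p := (\pi_(graph At) : cells At -> graph At)%qT.
pose H (gs : graph At * R) := cells_homotopy (repr gs.1, gs.2).
have qp : quotient_map p.
  (* The openness clause is the definition of the quotient topology. *)
  split; last by [].
  by apply/seteqP; split => // g _; exists (repr g) => //; exact: reprK.
have HE c s : H (p c, s) = cells_homotopy (c, s).
  rewrite /H -[LHS]cells_homotopy_attach -[RHS]cells_homotopy_attach.
  congr (cells_homotopy (_, s)).
  by rewrite /p; case: piP => c' /eqmodP/eqP.
apply: (@homotopic_of_continuous _ _ _ _ _ H).
- apply: (quotient_map_prod_continuous qp).
  rewrite (_ : (fun _ => _) = cells_homotopy).
    exact: cells_homotopy_continuous.
  by apply/funext => -[c s]; rewrite HE.
- move=> g; have [c _ <-] : range p g by rewrite qp.1.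
  rewrite HE /=; case: c => -[a []|b t].
    by rewrite -[p _]/(vertex a) surface_map_graph_map_vertex.
  rewrite -[p _]/(edge b t) -edge_at_val surface_map_graph_map_edge.
    by rewrite /cells_homotopy /= subr0 mul1r mul0r addr0.
  by have := set_valP t; rewrite /= in_itv.
- move=> g; have [c _ <-] : range p g by rewrite qp.1.
  rewrite HE; case: c => -[a []|b t] //.
  rewrite /cells_homotopy /= subrr mul0r add0r mul1r.
  by rewrite edge_at_val.
Qed.

Lemma graph_map_homotopy_equivalence : homotopy_equivalence R (graph_map z).
Proof.
split; first exact: graph_map_continuous.
exists surface_map; split; first exact: surface_map_continuous.
- exact: surface_map_graph_map_homotopic.
- exact: graph_map_surface_map_homotopic.
Qed.

End homotopy_inverse.

Theorem theorem2p8 (R : realType) (Z : topologicalType) (hZ : surface R Z)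
    (At : striped_atlas R Z) (z : seam_points At) :
  (forall x : graph At,
     group_isomorphism (@pi1_map R _ _ (graph_map z) (graph_map_continuous z) x))
  /\ homotopy_equivalence R (graph_map z).
Proof.
have hz := graph_map_homotopy_equivalence z.
by split => // x; exact: homotopy_equivalence_pi1.
Qed.
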